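(* Let $\lambda\in P_0^+$. Then $W^\Gamma(\lambda)$ is a finitely generated right $\mathbf A^\Gamma_\lambda$-module.
   Context: Let $\mathfrak g$ be a finite-dimensional simple complex Lie algebra with Cartan subalgebra $\mathfrak h$, triangular decomposition $\mathfrak g=\mathfrak n^-\oplus\mathfrak h\oplus\mathfrak n^+$, simple roots $\alpha_i$, Chevalley generators $X_i^\pm,H_i$ and fundamental weights $\omega_i$ ($i\in I$). Let $\sigma$ be a diagram automorphism of $\mathfrak g$ of order $m$ (so $\sigma(X_i^\pm)=X^\pm_{\sigma(i)}$, $\sigma(H_i)=H_{\sigma(i)}$ for an order $m$ automorphism of the Dynkin diagram), $\Gamma=\langle\sigma\rangle\cong\mathbb Z/m\mathbb Z$, and $\zeta$ a fixed primitive $m$-th root of unity. The fixed-point algebra $\mathfrak g_0=\mathfrak g^\sigma$ is simple with Cartan subalgebra $\mathfrak h_0=\mathfrak h\cap\mathfrak g_0$ and positive part $\mathfrak n^+\cap\mathfrak g_0$. Fix a set $I_0\subset I$ of representatives of the $\Gamma$-orbits on $I$; the simple roots of $\mathfrak g_0$ are the restrictions $\alpha_i|_{\mathfrak h_0}$, $i\in I_0$, and $Q_0^+$ is their $\mathbb Z_+$-span ($\mathbb Z_+$ the non-negative integers). $P_0^+$ is the $\mathbb Z_+$-span of the restrictions $\omega_i|_{\mathfrak h_0}$, $i\in I_0$. Let $A=\mathbb C[t^{\pm1}]$, $L(\mathfrak g)=\mathfrak g\otimes A$ with bracket $[x\otimes a,y\otimes b]=[x,y]\otimes ab$. $\Gamma$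 acts on $L(\mathfrak g)$ by $\sigma(x\otimes t^k)=\sigma(x)\otimes\zeta^kt^k$; $L^\Gamma(\mathfrak g)=L(\mathfrak g)^\Gamma$, $L^\Gamma(\mathfrak h)=(\mathfrak h\otimes A)^\Gamma$. For $\lambda\in P_0^+$, let $V(\lambda)$ be the simple finite-dimensional $\mathfrak g_0$-module of highest weight $\lambda$. The global Weyl module $W^\Gamma(\lambda)$ is the quotient of $U(L^\Gamma(\mathfrak g))\otimes_{U(\mathfrak g_0)}V(\lambda)$ by the $L^\Gamma(\mathfrak g)$-submodule generated by all $\mathfrak h_0$-weight spaces of weights $\mu$ with $\lambda-\mu\notin Q_0^+$; $w_\lambda$ is the image of $1\otimes v_\lambda$, $v_\lambda$ a highest weight vector. $\mathbf A_\lambda^\Gamma=U(L^\Gamma(\mathfrak h))/\mathrm{Ann}_{U(L^\Gamma(\mathfrak h))}(w_\lambda)$, a commutative algebra; it acts on $W^\Gamma(\lambda)$ on the right by $(uw_\lambda).a=ua\,w_\lambda$ for $u\in U(L^\Gamma(\mathfrak g))$ (this is well defined). *)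

(* Defs.v *)
From HB Require Import structures.
From mathcomp Require Import all_boot all_order all_fingroup all_algebra ring_quotient.
From mathcomp Require Import boolp.
From mathcomp Require Import finmap monalg.

Set Implicit Arguments.
Unset Strict Implicit.
Unset Printing Implicit Defensive.

Import GRing.Theory.
Import generic_quotient ring_quotient.Quotient.
Local Open Scope ring_scope.
Local Open Scope quotient_scope.

HB.mixin Record Lmodule_isLie (K : fieldType) L of GRing.Lmodule K L := {
  lie : L -> L -> L;
  lie_linearl : forall y, linear (lie^~ y);
  lie_linearr : forall x, linear (lie x);
  liexx : forall x, lie x x = 0;
  lie_jacobi : forall x y z,
    lie x (lie y z) + lie y (lie z x) + lie z (lie x y) = 0
}.

#[short(type="lieAlgType")]
HB.structure Definition LieAlgebra (K : fieldType) :=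
  { L of GRing.Lmodule K L & Lmodule_isLie K L }.

#[short(type="fdLieAlgType")]
HB.structure Definition FDLieAlgebra (K : fieldType) :=
  { L of Vector K L & LieAlgebra K L }.

HB.mixin Record LieAlgebra_isAbelian (K : fieldType) L of LieAlgebra K L := {
  lie_abelian : forall x y : L, lie x y = 0
}.

#[short(type="abLieAlgType")]
HB.structure Definition AbLieAlgebra (K : fieldType) :=
  { L of LieAlgebra K L & LieAlgebra_isAbelian K L }.

Notation "[Lie x , y ]" := (lie x y)
  (at level 0, x, y at level 99, format "[Lie x ,  y ]") : ring_scope.

Section LieTheory.
Variables (K : fieldType) (L : lieAlgType K).
Implicit Types x y z : L.

HB.instance Definition _ x := GRing.isLinear.Build K L L *:%R (lie x) (lie_linearr x).

Lemma lieDl x y z : [Lie x + y, z] = [Lie x, z] + [Lie y, z].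
Proof. by have := lie_linearl z 1 x y; rewrite !scale1r. Qed.

Lemma lie0l z : [Lie 0, z] = 0.
Proof. by apply: (addrI [Lie 0, z]); rewrite -lieDl !addr0. Qed.

Lemma lieZl a x z : [Lie a *: x, z] = a *: [Lie x, z].
Proof. by have := lie_linearl z a x 0; rewrite lie0l !addr0. Qed.

Lemma lieNl x z : [Lie - x, z] = - [Lie x, z].
Proof. by rewrite -scaleN1r lieZl scaleN1r. Qed.

Lemma lieDr x y z : [Lie x, y + z] = [Lie x, y] + [Lie x, z].
Proof. exact: raddfD. Qed.

Lemma lieZr a x z : [Lie x, a *: z] = a *: [Lie x, z].
Proof. exact: linearZ. Qed.

Lemma lie0r x : [Lie x, 0] = 0.
Proof. exact: raddf0. Qed.

Lemma lieNr x z : [Lie x, - z] = - [Lie x, z].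
Proof. exact: raddfN. Qed.

Lemma lie_antisym x y : [Lie x, y] = - [Lie y, x].
Proof.
apply/eqP; rewrite -addr_eq0; apply/eqP.
by have := liexx (x + y); rewrite lieDl !lieDr !liexx addr0 add0r.
Qed.

Lemma lie_suml (I : Type) (r : seq I) (P : pred I) (F : I -> L) z :
  [Lie \sum_(i <- r | P i) F i, z] = \sum_(i <- r | P i) [Lie F i, z].
Proof. exact: (big_morph (lie^~ z) (fun x y => lieDl x y z) (lie0l z)). Qed.

Lemma lie_sumr (I : Type) (r : seq I) (P : pred I) (F : I -> L) z :
  [Lie z, \sum_(i <- r | P i) F i] = \sum_(i <- r | P i) [Lie z, F i].
Proof. exact: raddf_sum. Qed.

End LieTheory.

(* Lie algebra morphisms, and morphisms from a Lie algebra to the commutator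
   Lie algebra of an associative algebra. *)
Record lieHom (K : fieldType) (L1 L2 : lieAlgType K) := LieHom {
  lieHom_fun :> {linear L1 -> L2};
  lieHom_lie : forall x y, lieHom_fun [Lie x, y] = [Lie lieHom_fun x, lieHom_fun y]
}.

Record lieAssoc (K : fieldType) (L : lieAlgType K) (A : algType K) := LieAssoc {
  lieAssoc_fun :> {linear L -> A};
  lieAssoc_lie : forall x y,
    lieAssoc_fun [Lie x, y]
    = lieAssoc_fun x * lieAssoc_fun y - lieAssoc_fun y * lieAssoc_fun x
}.

HB.mixin Record isLieClosed (K : fieldType) (L : lieAlgType K) (S : {pred L}) := {
  lie_closedP : {in S &, forall x y, [Lie x, y] \in S}
}.

#[short(type="lieSubalg")]
HB.structure Definition LieSubalg (K : fieldType) (L : lieAlgType K) :=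
  { S of GRing.SubmodClosed K S & isLieClosed K L S }.

Section SubLie.
Variables (K : fieldType) (L : lieAlgType K) (S : lieSubalg L).

Definition subLie := {x : L | x \in S}.

HB.instance Definition _ := SubChoice.on subLie.
HB.instance Definition _ := [SubChoice_isSubLmodule of subLie by <:].

Definition sub_lie (x y : subLie) : subLie :=
  exist _ [Lie val x, val y] (lie_closedP _ _ (valP x) (valP y)).

Fact sub_lie_linearl y : linear (sub_lie^~ y).
Proof. by move=> a u v; apply/val_inj; rewrite /= lieDl lieZl. Qed.

Fact sub_lie_linearr x : linear (sub_lie x).
Proof. by move=> a u v; apply/val_inj; rewrite /= lieDr lieZr. Qed.

Fact sub_liexx x : sub_lie x x = 0.
Proof. by apply/val_inj; rewrite /= liexx. Qed.

Fact sub_lie_jacobi x y z :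
  sub_lie x (sub_lie y z) + sub_lie y (sub_lie z x) + sub_lie z (sub_lie x y) = 0.
Proof. by apply/val_inj; rewrite /= lie_jacobi. Qed.

HB.instance Definition _ := Lmodule_isLie.Build K subLie
  sub_lie_linearl sub_lie_linearr sub_liexx sub_lie_jacobi.

End SubLie.

Section Quotients.
Variables (R : nzRingType) (M : lmodType R).

Inductive span_of (G : M -> Prop) : M -> Prop :=
| span_of0 : span_of G 0
| span_of_gen x : G x -> span_of G x
| span_of_lin a x y : span_of G x -> span_of G y -> span_of G (a *: x + y).

Definition submod_gen (G : M -> Prop) : {pred M} := fun x => `[< span_of G x >].

Fact submod_gen_closed G : submod_closed (submod_gen G).
Proof.
split; first by apply/asboolP; exact: span_of0.
by move=> a x y /asboolP Gx /asboolP Gy; apply/asboolP; exact: span_of_lin.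
Qed.

HB.instance Definition _ G :=
  GRing.isSubmodClosed.Build R M (submod_gen G) (submod_gen_closed G).

End Quotients.

Section LmodQuot.
Variables (R : nzRingType) (M : lmodType R) (S : submodClosed M).

Definition submod_pred : {pred M} := fun x => x \in S.

Lemma submod_predE x : (x \in submod_pred) = (x \in S). Proof. by []. Qed.

Fact submod_pred_closed : zmod_closed submod_pred.
Proof.
split=> [|x y Sx Sy]; first exact: (rpred0 S).
by rewrite submod_predE rpredD // -scaleN1r rpredZ.
Qed.
HB.instance Definition _ := GRing.isZmodClosed.Build M submod_pred submod_pred_closed.

Definition lquot := quot submod_pred.
HB.instance Definition _ := GRing.Zmodule.on lquot.
HB.instance Definition _ := EqQuotient.on lquot.
HB.instance Definition _ := ZmodQuotient.on lquot.

End LmodQuot.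

HB.lock Definition lquot_scale (R : nzRingType) (M : lmodType R) (S : submodClosed M)
  (a : R) (x : lquot S) : lquot S := \pi_(lquot S) (a *: repr x).

Section LmodQuotTheory.
Variables (R : nzRingType) (M : lmodType R) (S : submodClosed M).

Local Notation lquot := (lquot S).
Local Notation lquot_scale := (@lquot_scale R M S).

Fact pi_scale a x : \pi_(lquot) (a *: x) = lquot_scale a (\pi x).
Proof.
rewrite lquot_scale.unlock; apply/eqP; rewrite -idealrBE -scalerBr submod_predE; apply: rpredZ.
by rewrite -submod_predE idealrBE reprK.
Qed.

Fact lquot_scaleA a b x : lquot_scale a (lquot_scale b x) = lquot_scale (a * b) x.
Proof. by rewrite -[x]reprK -(pi_scale b) -(pi_scale a) -pi_scale scalerA. Qed.
Fact lquot_scale1 : left_id 1 lquot_scale.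
Proof. by move=> x; rewrite -[x]reprK -pi_scale scale1r. Qed.
Fact lquot_scaleDr : right_distributive lquot_scale +%R.
Proof.
move=> a x y; rewrite -[x]reprK -[y]reprK -raddfD -!pi_scale -raddfD.
by rewrite scalerDr.
Qed.
Fact lquot_scaleDl x : {morph lquot_scale^~ x : a b / a + b}.
Proof. by move=> a b; rewrite -[x]reprK -!pi_scale -raddfD scalerDl. Qed.

HB.instance Definition _ := GRing.Zmodule_isLmodule.Build R lquot
  lquot_scaleA lquot_scale1 lquot_scaleDr lquot_scaleDl.

Definition lpi (x : M) : lquot := \pi_(lquot) x.

Fact lpi_linear : linear lpi.
Proof. by move=> a x y; rewrite /lpi raddfD /= pi_scale. Qed.
HB.instance Definition _ := GRing.isLinear.Build R M lquot *:%R lpi lpi_linear.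

Lemma lpi_eq0 x : (lpi x == 0) = (x \in S).
Proof. by rewrite -(raddf0 lpi) /lpi -idealrBE subr0. Qed.

Lemma lpiP (q : lquot) : exists x, q = lpi x.
Proof. by exists (repr q); rewrite /lpi reprK. Qed.

End LmodQuotTheory.

Section IdealGen.
Variables (A : nzRingType).

Inductive ideal_of (G : A -> Prop) : A -> Prop :=
| ideal_of0 : ideal_of G 0
| ideal_of_gen a x b y : G x -> ideal_of G y -> ideal_of G (a * x * b + y).

Lemma ideal_ofD G x y : ideal_of G x -> ideal_of G y -> ideal_of G (x + y).
Proof.
elim=> [|a z b u Gz _ IH] Gy; first by rewrite add0r.
by rewrite -addrA; apply: ideal_of_gen; [|exact: IH].
Qed.

Lemma ideal_ofMl G c x : ideal_of G x -> ideal_of G (c * x).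
Proof.
elim=> [|a z b u Gz _ IH]; first by rewrite mulr0; exact: ideal_of0.
by rewrite mulrDr !mulrA; exact: ideal_of_gen.
Qed.

Lemma ideal_ofMr G c x : ideal_of G x -> ideal_of G (x * c).
Proof.
elim=> [|a z b u Gz _ IH]; first by rewrite mul0r; exact: ideal_of0.
by rewrite mulrDl -mulrA; exact: ideal_of_gen.
Qed.

Definition ideal_gen (G : A -> Prop) : {pred A} := fun x => `[< ideal_of G x >].

Fact ideal_gen_closed G : zmod_closed (ideal_gen G).
Proof.
split=> [|x y /asboolP Gx /asboolP Gy]; apply/asboolP; first exact: ideal_of0.
by apply: ideal_ofD => //; rewrite -mulN1r; exact: ideal_ofMl.
Qed.

HB.instance Definition _ G :=
  GRing.isZmodClosed.Build A (ideal_gen G) (ideal_gen_closed G).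

Lemma ideal_genMl G c x : x \in ideal_gen G -> c * x \in ideal_gen G.
Proof. by move=> /asboolP Gx; apply/asboolP; exact: ideal_ofMl. Qed.

Lemma ideal_genMr G c x : x \in ideal_gen G -> x * c \in ideal_gen G.
Proof. by move=> /asboolP Gx; apply/asboolP; exact: ideal_ofMr. Qed.

End IdealGen.

Lemma ideal_gen_gen (A : nzRingType) (G : A -> Prop) x : G x -> x \in ideal_gen G.
Proof.
move=> Gx; apply/asboolP; rewrite -[x]mul1r -[_ * _]mulr1 -[_ * _]addr0.
by apply: ideal_of_gen => //; exact: ideal_of0.
Qed.

HB.mixin Record isIdeal2 (A : nzRingType) (S : {pred A}) := {
  ideal2Ml : forall c x, x \in S -> c * x \in S;
  ideal2Mr : forall c x, x \in S -> x * c \in S;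
  ideal2_1 : 1 \notin S
}.

#[short(type="ideal2")]
HB.structure Definition Ideal2 (A : nzRingType) :=
  { S of GRing.ZmodClosed A S & isIdeal2 A S }.

Section AlgQuot.
Variables (K : fieldType) (A : algType K) (J : ideal2 A).

Definition aquot := quot J.
HB.instance Definition _ := GRing.Zmodule.on aquot.
HB.instance Definition _ := EqQuotient.on aquot.
HB.instance Definition _ := ZmodQuotient.on aquot.

Definition aquot_one : aquot := \pi_aquot 1.

End AlgQuot.

HB.lock Definition aquot_mul (K : fieldType) (A : algType K) (J : ideal2 A)
  (x y : aquot J) : aquot J := \pi_(aquot J) (repr x * repr y).

HB.lock Definition aquot_scale (K : fieldType) (A : algType K) (J : ideal2 A)
  (a : K) (x : aquot J) : aquot J := \pi_(aquot J) (a *: repr x).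

Section AlgQuotTheory.
Variables (K : fieldType) (A : algType K) (J : ideal2 A).

Local Notation aquot := (aquot J).
Local Notation aquot_one := (aquot_one J).
Local Notation aquot_mul := (@aquot_mul K A J).
Local Notation aquot_scale := (@aquot_scale K A J).

Fact pi_aquot_mul x y : \pi_(aquot) (x * y) = aquot_mul (\pi x) (\pi y).
Proof.
rewrite aquot_mul.unlock; apply/eqP; rewrite -idealrBE.
rewrite -[x * y](addrNK (x * repr (\pi_(aquot) y))) -mulrBr -addrA -mulrBl rpredD //.
  by apply: ideal2Ml; rewrite idealrBE reprK.
by apply: ideal2Mr; rewrite idealrBE reprK.
Qed.

Fact pi_aquot_scale a x : \pi_(aquot) (a *: x) = aquot_scale a (\pi x).
Proof.
rewrite aquot_scale.unlock; apply/eqP; rewrite -idealrBE -scalerBr -mulr_algl.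
by apply: ideal2Ml; rewrite idealrBE reprK.
Qed.

Fact aquot_mulA : associative aquot_mul.
Proof.
by move=> x y z; rewrite -[x]reprK -[y]reprK -[z]reprK -!pi_aquot_mul mulrA.
Qed.
Fact aquot_mul1 : left_id aquot_one aquot_mul.
Proof. by move=> x; rewrite -[x]reprK -pi_aquot_mul mul1r. Qed.
Fact aquot_mulr1 : right_id aquot_one aquot_mul.
Proof. by move=> x; rewrite -[x]reprK -pi_aquot_mul mulr1. Qed.
Fact aquot_mulDl : left_distributive aquot_mul +%R.
Proof.
move=> x y z; rewrite -[x]reprK -[y]reprK -[z]reprK -raddfD -!pi_aquot_mul.
by rewrite mulrDl raddfD.
Qed.
Fact aquot_mulDr : right_distributive aquot_mul +%R.
Proof.
move=> x y z; rewrite -[x]reprK -[y]reprK -[z]reprK -raddfD -!pi_aquot_mul.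
by rewrite mulrDr raddfD.
Qed.
Fact aquot_one_neq0 : aquot_one != 0.
Proof. by rewrite -(raddf0 (\pi_(aquot))) -idealrBE subr0 ideal2_1. Qed.

HB.instance Definition _ := GRing.Zmodule_isNzRing.Build aquot
  aquot_mulA aquot_mul1 aquot_mulr1 aquot_mulDl aquot_mulDr aquot_one_neq0.

Fact aquot_scaleA a b x : aquot_scale a (aquot_scale b x) = aquot_scale (a * b) x.
Proof. by rewrite -[x]reprK -!pi_aquot_scale scalerA. Qed.
Fact aquot_scale1 : left_id 1 aquot_scale.
Proof. by move=> x; rewrite -[x]reprK -pi_aquot_scale scale1r. Qed.
Fact aquot_scaleDr : right_distributive aquot_scale +%R.
Proof.
move=> a x y; rewrite -[x]reprK -[y]reprK -raddfD -!pi_aquot_scale -raddfD.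
by rewrite scalerDr.
Qed.
Fact aquot_scaleDl x : {morph aquot_scale^~ x : a b / a + b}.
Proof. by move=> a b; rewrite -[x]reprK -!pi_aquot_scale -raddfD scalerDl. Qed.

HB.instance Definition _ := GRing.Zmodule_isLmodule.Build K aquot
  aquot_scaleA aquot_scale1 aquot_scaleDr aquot_scaleDl.

Fact aquot_scaleAl (a : K) (x y : aquot) : a *: (x * y) = (a *: x) * y.
Proof.
change (aquot_scale a (aquot_mul x y) = aquot_mul (aquot_scale a x) y).
by rewrite -[x]reprK -[y]reprK -!(pi_aquot_mul, pi_aquot_scale) scalerAl.
Qed.
HB.instance Definition _ := GRing.Lmodule_isLalgebra.Build K aquot aquot_scaleAl.

Fact aquot_scaleAr (a : K) (x y : aquot) : a *: (x * y) = x * (a *: y).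
Proof.
change (aquot_scale a (aquot_mul x y) = aquot_mul x (aquot_scale a y)).
by rewrite -[x]reprK -[y]reprK -!(pi_aquot_mul, pi_aquot_scale) scalerAr.
Qed.
HB.instance Definition _ := GRing.Lalgebra_isAlgebra.Build K aquot aquot_scaleAr.

Definition api (p : A) : aquot := \pi_(aquot) p.
Fact api_linear : linear api.
Proof. by move=> a x y; rewrite /api raddfD /= pi_aquot_scale. Qed.
HB.instance Definition _ := GRing.isLinear.Build K A aquot *:%R api api_linear.
Fact api_monoid_morphism : monoid_morphism api.
Proof. by split=> [//|x y]; rewrite /api pi_aquot_mul. Qed.
HB.instance Definition _ := GRing.isMonoidMorphism.Build A aquot api api_monoid_morphism.

Lemma api_eq0 p : (api p == 0) = (p \in J).
Proof. by rewrite -(raddf0 api) /api -idealrBE subr0. Qed.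

Lemma apiP (u : aquot) : exists p, u = api p.
Proof. by exists (repr u); rewrite /api reprK. Qed.

(* Meaningful when f kills J, see aquot_lift_api. *)
Definition aquot_lift (B : Type) (f : A -> B) (u : aquot) : B := f (repr u).

Lemma aquot_lift_api (B : zmodType) (f : {additive A -> B}) p :
  (forall q, q \in J -> f q = 0) -> aquot_lift f (api p) = f p.
Proof.
move=> fJ; apply/eqP; rewrite -subr_eq0 -raddfB; apply/eqP/fJ.
by rewrite idealrBE reprK.
Qed.

End AlgQuotTheory.

Lemma rmorph_commutator (A B : nzRingType) (f : {rmorphism A -> B}) c x y :
  f (c - (x * y - y * x)) = f c - (f x * f y - f y * f x).
Proof. by rewrite !rmorphB !rmorphM. Qed.

Section Enveloping.
Variables (K : fieldType) (L : lieAlgType K).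

(* U(L) is the free associative algebra on the set L modulo the two-sided ideal
   generated by the linearity relations (which cut out the tensor algebra T(L))
   and by [x, y] - (x y - y x). *)
Definition free_alg := {malg K[{fmonom L}]}.
HB.instance Definition _ := GRing.Lalgebra.on free_alg.

Fact free_scaleAr (a : K) (x y : free_alg) : a *: (x * y) = x * (a *: y).
Proof.
have aC : (a%:MP : free_alg) * x = x * a%:MP.
  rewrite mul_malgC malgM_def fgmulgU malgZ_def /fgscale.
  by apply: eq_bigr => i _; rewrite mulm1 mulrC.
have sC z : a *: z = (a%:MP : free_alg) * z by rewrite mul_malgC.
rewrite (sC (x * y)) (sC y) mulrA aC; exact: esym (mulrA _ _ _).
Qed.
HB.instance Definition _ := GRing.Lalgebra_isAlgebra.Build K free_alg free_scaleAr.

Definition fgen (x : L) : free_alg := << fmu x >>.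

Inductive env_rel : free_alg -> Prop :=
| env_rel_linear a x y :
    env_rel (fgen (a *: x + y) - (a *: fgen x + fgen y))
| env_rel_lie x y :
    env_rel (fgen [Lie x, y] - (fgen x * fgen y - fgen y * fgen x)).

Definition env_ideal : {pred free_alg} := ideal_gen env_rel.
HB.instance Definition _ := GRing.ZmodClosed.on env_ideal.

Definition fcoef1 : free_alg -> K := mcoeff (mone : {fmonom L}).
HB.instance Definition _ := GRing.RMorphism.copy fcoef1 (mcoeff (mone : {fmonom L})).

Fact fcoef1Z a p : fcoef1 (a *: p) = a * fcoef1 p.
Proof. exact: mcoeffZ. Qed.

Fact fcoef1_gen x : fcoef1 (fgen x) = 0.
Proof. by rewrite /fcoef1 mcoeffU fm1_eq1. Qed.

Fact env_ideal1 : 1 \notin env_ideal.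
Proof.
suff J0 p : p \in env_ideal -> fcoef1 p = 0.
  by apply/negP => /J0 /eqP; rewrite rmorph1 oner_eq0.
move=> /asboolP; elim=> [|a z b y Gz _ IH]; first by rewrite rmorph0.
rewrite rmorphD /= IH addr0 !rmorphM /=; suff -> : fcoef1 z = 0 by rewrite mulr0 mul0r.
case: Gz => [c u v|u v].
  by rewrite rmorphB /= rmorphD /= fcoef1Z !fcoef1_gen mulr0 addr0 subrr.
by rewrite rmorph_commutator /= !fcoef1_gen mulr0 !subrr.
Qed.

HB.instance Definition _ := isIdeal2.Build free_alg env_ideal
  (@ideal_genMl _ env_rel) (@ideal_genMr _ env_rel) env_ideal1.

Definition env := aquot env_ideal.
HB.instance Definition _ := GRing.Algebra.on env.

Definition env_in (x : L) : env := api env_ideal (fgen x).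

Fact epi_rel p : env_rel p -> api env_ideal p = 0.
Proof. by move=> Rp; apply/eqP; rewrite api_eq0; exact: ideal_gen_gen. Qed.

Fact env_in_linear : linear env_in.
Proof.
move=> a x y; have /epi_rel/eqP := env_rel_linear a x y.
by rewrite raddfB raddfD /= linearZ subr_eq0 => /eqP.
Qed.
HB.instance Definition _ := GRing.isLinear.Build K L env *:%R env_in env_in_linear.

Fact env_in_lie x y : env_in [Lie x, y] = env_in x * env_in y - env_in y * env_in x.
Proof.
have /epi_rel/eqP := env_rel_lie x y.
by rewrite rmorph_commutator subr_eq0 => /eqP.
Qed.

Definition envU : lieAssoc L env := LieAssoc (lieAssoc_fun := env_in) env_in_lie.

Section Lift.
Variables (A : algType K) (f : lieAssoc L A).

Definition fmon_eval (m : {fmonom L}) : A := \prod_(x <- m) f x.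

Fact fmon_eval_mmorphism : mmorphism fmon_eval.
Proof.
split=> [x y|]; rewrite /fmon_eval; first by rewrite fmM big_cat.
by rewrite fm1 big_nil.
Qed.
HB.instance Definition _ := isMultiplicative.Build {fmonom L} A fmon_eval fmon_eval_mmorphism.

Definition free_lift (p : free_alg) : A := mmap (in_alg A) fmon_eval p.

Fact free_lift_linear : linear free_lift.
Proof. by move=> a p q; rewrite /free_lift raddfD /= mmapZ mulr_algl. Qed.
HB.instance Definition _ := GRing.isLinear.Build K free_alg A *:%R free_lift free_lift_linear.

Fact free_lift_monoid_morphism : monoid_morphism free_lift.
Proof.
have [M1 M2] : multiplicative (mmap (in_alg A) fmon_eval).
  by apply: commr_mmap_is_multiplicative => p m m'; rewrite /GRing.comm mulr_algl mulr_algr.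
by split.
Qed.
HB.instance Definition _ :=
  GRing.isMonoidMorphism.Build free_alg A free_lift free_lift_monoid_morphism.

Lemma free_lift_gen x : free_lift (fgen x) = f x.
Proof. by rewrite /free_lift mmapU /= scale1r mul1r /fmon_eval fmU big_seq1. Qed.

Lemma free_lift_ideal p : p \in env_ideal -> free_lift p = 0.
Proof.
move=> /asboolP; elim=> [|a z b y Gz _ IH]; first by rewrite raddf0.
rewrite raddfD /= IH addr0 !rmorphM /=.
suff -> : free_lift z = 0 by rewrite mulr0 mul0r.
case: Gz => [c u v|u v].
  by rewrite raddfB raddfD /= linearZ /= !free_lift_gen linearP subrr.
by rewrite rmorph_commutator /= !free_lift_gen lieAssoc_lie subrr.
Qed.

Definition env_lift (u : env) : A := aquot_lift free_lift u.

Lemma env_lift_epi p : env_lift (api env_ideal p) = free_lift p.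
Proof. by apply: aquot_lift_api; exact: free_lift_ideal. Qed.

Lemma env_lift_in x : env_lift (envU x) = f x.
Proof. by rewrite env_lift_epi free_lift_gen. Qed.

Fact env_lift_linear : linear env_lift.
Proof.
move=> a u v; have [p ->] := apiP u; have [q ->] := apiP v.
by rewrite -linearP !env_lift_epi linearP.
Qed.
HB.instance Definition _ := GRing.isLinear.Build K env A *:%R env_lift env_lift_linear.

Fact env_lift_monoid_morphism : monoid_morphism env_lift.
Proof.
split=> [|u v]; first by rewrite -(rmorph1 (api env_ideal)) env_lift_epi rmorph1.
have [p ->] := apiP u; have [q ->] := apiP v.
by rewrite -rmorphM !env_lift_epi rmorphM.
Qed.
HB.instance Definition _ :=
  GRing.isMonoidMorphism.Build env A env_lift env_lift_monoid_morphism.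

End Lift.

Lemma env_ind (P : env -> Prop) :
  P 1 -> (forall a u v, P u -> P v -> P (a *: u + v)) ->
  (forall x u, P u -> P (envU x * u)) -> forall u, P u.
Proof.
move=> P1 PD PM u; have [p ->] := apiP u.
have P0 : P 0 by have := PD (-1) 1 1 P1 P1; rewrite scaleN1r addNr.
rewrite [p]monalgE raddf_sum; elim/big_ind: _ => // [v w Pv Pw|m _].
  by have := PD 1 v w Pv Pw; rewrite scale1r.
have -> : << p@_m *g m >> = p@_m *: (<< m >> : free_alg) :> free_alg.
  by apply/malgP=> k; rewrite [RHS]mcoeffZ !mcoeffU mulrnAr mulr1.
rewrite /= linearZ -[X in P X]addr0; apply: PD => //.
case: m => s; elim: s => [|x s IH].
  have -> : FMonom [::] = mone :> {fmonom L} by apply/eqP; rewrite fmP fm1.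
  by have := P1; rewrite -(rmorph1 (api env_ideal)).
have -> : FMonom (x :: s) = mmul (fmu x) (FMonom s) :> {fmonom L}.
  by apply/eqP; rewrite fmP fmM fmU.
have -> : << mmul (fmu x) (FMonom s) >> = fgen x * (<< FMonom s >> : free_alg) :> free_alg.
  by rewrite [RHS]malgM_def fgmulUU mulr1.
have := PM x _ IH; rewrite -(rmorphM (api env_ideal)); exact.
Qed.

End Enveloping.

Section EnvFunctor.
Variables (K : fieldType).

Section Map.
Variables (L1 L2 : lieAlgType K) (f : lieHom L1 L2).

Definition env_map_gen (x : L1) : env L2 := envU L2 (f x).

Fact env_map_gen_linear : linear env_map_gen.
Proof. by move=> a x y; rewrite /env_map_gen !linearP. Qed.
HB.instance Definition _ :=
  GRing.isLinear.Build K L1 (env L2) *:%R env_map_gen env_map_gen_linear.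

Fact env_map_gen_lie x y :
  env_map_gen [Lie x, y] = env_map_gen x * env_map_gen y - env_map_gen y * env_map_gen x.
Proof. by rewrite /env_map_gen lieHom_lie lieAssoc_lie. Qed.

Definition env_map : env L1 -> env L2 :=
  env_lift (LieAssoc (lieAssoc_fun := env_map_gen) env_map_gen_lie).
HB.instance Definition _ := GRing.RMorphism.on env_map.
HB.instance Definition _ := GRing.Linear.on env_map.

Lemma env_map_in x : env_map (envU L1 x) = envU L2 (f x).
Proof. exact: env_lift_in. Qed.
End Map.

Fact env_mulC (L : abLieAlgType K) : commutative (@GRing.mul (env L)).
Proof.
move=> u v; elim/env_ind: u => [|a u w IHu IHw|x u IHu].
- by rewrite mul1r mulr1.
- by rewrite mulrDl mulrDr IHw -scalerAl -scalerAr IHu.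
suff xv : envU L x * v = v * envU L x by rewrite -mulrA IHu mulrA xv mulrA.
elim/env_ind: v {u IHu} => [|a u w IHu IHw|y u IHu].
- by rewrite mul1r mulr1.
- by rewrite mulrDl mulrDr IHw -scalerAl -scalerAr IHu.
have xy : envU L x * envU L y = envU L y * envU L x.
  by apply/eqP; rewrite -subr_eq0 -lieAssoc_lie lie_abelian raddf0.
by rewrite mulrA xy -!mulrA IHu.
Qed.

HB.instance Definition _ (L : abLieAlgType K) :=
  GRing.PzRing_hasCommutativeMul.Build (env L) (@env_mulC L).

End EnvFunctor.

Section ExtScalars.
Variables (R S : nzRingType) (phi : {rmorphism S -> R}) (V : lmodType S).

(* R \otimes_S V for a ring morphism phi : S -> R, as the free left R-module on
   the symbols << v >> = 1 \otimes v modulo additivity and S-balancedness;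
   r \otimes v is the class of r *: << v >>. *)
Inductive tensor_rel : {malg R[V]} -> Prop :=
| tensor_rel_add v w : tensor_rel (<< v + w >> - << v >> - << w >>)
| tensor_rel_scale s v : tensor_rel (<< s *: v >> - phi s *: << v >>).

Definition ext_scalars := lquot (submod_gen tensor_rel).
HB.instance Definition _ := GRing.Lmodule.on ext_scalars.

Definition tens (r : R) (v : V) : ext_scalars :=
  lpi (submod_gen tensor_rel) (r *: << v >>).

End ExtScalars.

Section AnnQuot.
Variables (R : comNzRingType) (S : nzRingType) (phi : {rmorphism R -> S}).
Variables (M : lmodType S) (w : M).

(* M is an S-module, seen as an R-module through phi : R -> S; R is commutative,
   so that the annihilator of w in R is a two-sided ideal. *)
Definition ann : {pred R} := fun a => phi a *: w == 0.

Lemma annE a : (a \in ann) = (phi a *: w == 0). Proof. by []. Qed.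

Fact ann_closed : zmod_closed ann.
Proof.
split=> [|a b]; rewrite !annE; first by rewrite rmorph0 scale0r.
by move=> /eqP wa /eqP wb; rewrite rmorphB scalerBl wa wb subrr.
Qed.
HB.instance Definition _ := GRing.isZmodClosed.Build R ann ann_closed.

Lemma ann_mul c a : a \in ann -> c * a \in ann.
Proof. by rewrite !annE => /eqP wa; rewrite rmorphM -scalerA wa scaler0. Qed.

Definition ann_quot := quot ann.
HB.instance Definition _ := GRing.Zmodule.on ann_quot.
HB.instance Definition _ := EqQuotient.on ann_quot.
HB.instance Definition _ := ZmodQuotient.on ann_quot.

Definition ann_quot_one : ann_quot := \pi_ann_quot 1.

End AnnQuot.

HB.lock Definition ann_quot_mul (R : comNzRingType) (S : nzRingType)
  (phi : {rmorphism R -> S}) (M : lmodType S) (w : M)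
  (x y : ann_quot phi w) : ann_quot phi w := \pi_(ann_quot phi w) (repr x * repr y).

Section AnnQuotTheory.
Variables (R : comNzRingType) (S : nzRingType) (phi : {rmorphism R -> S}).
Variables (M : lmodType S) (w : M).

Local Notation ann := (ann phi w).
Local Notation ann_quot := (ann_quot phi w).
Local Notation ann_quot_one := (ann_quot_one phi w).
Local Notation ann_quot_mul := (@ann_quot_mul R S phi M w).

Fact pi_ann_quot_mul x y : \pi_(ann_quot) (x * y) = ann_quot_mul (\pi x) (\pi y).
Proof.
rewrite ann_quot_mul.unlock; apply/eqP; rewrite -idealrBE.
rewrite -[x * y](addrNK (x * repr (\pi_(ann_quot) y))) -mulrBr -addrA -mulrBl rpredD //.
  by apply: ann_mul; rewrite idealrBE reprK.
by rewrite mulrC; apply: ann_mul; rewrite idealrBE reprK.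
Qed.

Fact ann_quot_mulA : associative ann_quot_mul.
Proof.
by move=> x y z; rewrite -[x]reprK -[y]reprK -[z]reprK -!pi_ann_quot_mul mulrA.
Qed.
Fact ann_quot_mulC : commutative ann_quot_mul.
Proof. by move=> x y; rewrite -[x]reprK -[y]reprK -!pi_ann_quot_mul mulrC. Qed.
Fact ann_quot_mul1 : left_id ann_quot_one ann_quot_mul.
Proof. by move=> x; rewrite -[x]reprK -pi_ann_quot_mul mul1r. Qed.
Fact ann_quot_mulDl : left_distributive ann_quot_mul +%R.
Proof.
move=> x y z; rewrite -[x]reprK -[y]reprK -[z]reprK -raddfD -!pi_ann_quot_mul.
by rewrite mulrDl raddfD.
Qed.

HB.instance Definition _ := GRing.Zmodule_isComPzRing.Build ann_quot
  ann_quot_mulA ann_quot_mulC ann_quot_mul1 ann_quot_mulDl.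

Definition annpi (a : R) : ann_quot := \pi_(ann_quot) a.
Fact annpi_zmod_morphism : zmod_morphism annpi.
Proof. by move=> x y; rewrite /annpi raddfB. Qed.
HB.instance Definition _ := GRing.isZmodMorphism.Build R ann_quot annpi annpi_zmod_morphism.
Fact annpi_monoid_morphism : monoid_morphism annpi.
Proof. by split=> [//|x y]; rewrite /annpi pi_ann_quot_mul. Qed.
HB.instance Definition _ :=
  GRing.isMonoidMorphism.Build R ann_quot annpi annpi_monoid_morphism.

End AnnQuotTheory.

Section Loop.
Variables (K : fieldType) (g : lieAlgType K).

(* g \otimes K[t, t^-1] as finitely supported functions int -> g: the coefficient
   f@_k is the coefficient of t^k, and lmono x k is x \otimes t^k. *)
Definition loop := {malg g[int]}.
HB.instance Definition _ := GRing.Zmodule.on loop.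

Implicit Types f h : loop.

Definition loop_map (c : int -> g -> g) f : loop :=
  \sum_(k <- msupp f) << c k f@_k *g k >>.

Lemma loop_mapE (c : int -> g -> g) f k : (c k 0 = 0) -> (loop_map c f)@_k = c k f@_k.
Proof.
move=> c0; rewrite /loop_map raddf_sum /=; case: (msuppP f k) => kf.
  rewrite (big_fsetD1 k) //= mcoeffUU big1_fset ?addr0 // => i.
  by rewrite in_fsetD1 => /andP[/negPf ik _] _; rewrite mcoeffU ik.
rewrite big_seq big1 ?c0 // => i i_f; rewrite mcoeffU.
by case: eqP => // ik; move: kf; rewrite -ik i_f.
Qed.

Definition loop_scale (a : K) f : loop := loop_map (fun=> *:%R a) f.

Lemma loop_scaleE a f k : (loop_scale a f)@_k = a *: f@_k.
Proof. by rewrite loop_mapE ?scaler0. Qed.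

Fact loop_scaleA a b f : loop_scale a (loop_scale b f) = loop_scale (a * b) f.
Proof. by apply/malgP => k; rewrite !loop_scaleE scalerA. Qed.
Fact loop_scale1 : left_id 1 loop_scale.
Proof. by move=> f; apply/malgP => k; rewrite !loop_scaleE scale1r. Qed.
Fact loop_scaleDr : right_distributive loop_scale +%R.
Proof. by move=> a f h; apply/malgP => k; rewrite mcoeffD !loop_scaleE mcoeffD scalerDr. Qed.
Fact loop_scaleDl f : {morph loop_scale^~ f : a b / a + b}.
Proof. by move=> a b; apply/malgP => k; rewrite mcoeffD !loop_scaleE scalerDl. Qed.
HB.instance Definition _ := GRing.Zmodule_isLmodule.Build K loop
  loop_scaleA loop_scale1 loop_scaleDr loop_scaleDl.

Definition lmono (x : g) (k : int) : loop := << x *g k >>.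

Lemma lmono_coef x k i : (lmono x k)@_i = x *+ (k == i).
Proof. exact: mcoeffU. Qed.

Lemma loop_coefZ (a : K) f k : (a *: f)@_k = a *: f@_k.
Proof. exact: loop_scaleE. Qed.

Fact lmono_linear k : linear (lmono^~ k).
Proof.
move=> a x y; apply/malgP=> i.
by rewrite mcoeffD loop_coefZ !lmono_coef mulrnDl scalerMnr.
Qed.

Lemma loopE f : f = \sum_(k <- msupp f) lmono f@_k k.
Proof. exact: monalgE. Qed.

End Loop.

HB.lock Definition loop_lie (K : fieldType) (g : lieAlgType K) (f h : loop g) : loop g :=
  \sum_(i <- msupp f) \sum_(j <- msupp h) lmono [Lie f@_i, h@_j] (i + j).

Section LoopTheory.
Variables (K : fieldType) (g : lieAlgType K).
Local Notation loop := (loop g).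
Local Notation loop_lie := (@loop_lie K g).
Implicit Types f h : loop.

Lemma lmono0 k : lmono (0 : g) k = 0.
Proof. exact: monalgU0. Qed.

Lemma loop_lieEw (d1 d2 : {fset int}) f h :
  (msupp f `<=` d1)%fset -> (msupp h `<=` d2)%fset ->
  loop_lie f h = \sum_(i <- d1) \sum_(j <- d2) lmono [Lie f@_i, h@_j] (i + j).
Proof.
move=> le1 le2; rewrite loop_lie.unlock (big_fset_incl _ le1) /=.
  apply: eq_bigr => i _; apply: big_fset_incl => // j _ /mcoeff_outdom ->.
  by rewrite lie0r lmono0.
by move=> i _ /mcoeff_outdom ->; rewrite big1 // => j _; rewrite lie0l lmono0.
Qed.

Fact loop_lie_linearl h : linear (loop_lie^~ h).
Proof.
move=> a f1 f2; pose d := (msupp (a *: f1 + f2) `|` (msupp f1 `|` msupp f2))%fset.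
have s0 : (msupp (a *: f1 + f2) `<=` d)%fset by exact: fsubsetUl.
have s1 : (msupp f1 `<=` d)%fset by rewrite /d fsetUCA fsubsetUl.
have s2 : (msupp f2 `<=` d)%fset by rewrite /d fsetUA fsubsetUr.
rewrite (loop_lieEw s0 (fsubset_refl (msupp h))) (loop_lieEw s1 (fsubset_refl (msupp h))) (loop_lieEw s2 (fsubset_refl (msupp h))).
rewrite scaler_sumr -big_split /=; apply: eq_bigr => i _.
rewrite scaler_sumr -big_split /=; apply: eq_bigr => j _.
by rewrite mcoeffD loop_coefZ lieDl lieZl lmono_linear.
Qed.

Fact loop_lie_linearr f : linear (loop_lie f).
Proof.
move=> a f1 f2; pose d := (msupp (a *: f1 + f2) `|` (msupp f1 `|` msupp f2))%fset.
have s0 : (msupp (a *: f1 + f2) `<=` d)%fset by exact: fsubsetUl.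
have s1 : (msupp f1 `<=` d)%fset by rewrite /d fsetUCA fsubsetUl.
have s2 : (msupp f2 `<=` d)%fset by rewrite /d fsetUA fsubsetUr.
rewrite (loop_lieEw (fsubset_refl (msupp f)) s0) (loop_lieEw (fsubset_refl (msupp f)) s1) (loop_lieEw (fsubset_refl (msupp f)) s2).
rewrite scaler_sumr -big_split /=; apply: eq_bigr => i _.
rewrite scaler_sumr -big_split /=; apply: eq_bigr => j _.
by rewrite mcoeffD loop_coefZ lieDr lieZr lmono_linear.
Qed.

Lemma loop_lie_mono x y i j : loop_lie (lmono x i) (lmono y j) = lmono [Lie x, y] (i + j).
Proof. by rewrite (loop_lieEw msuppU_le msuppU_le) !big_seq_fset1 !lmono_coef !eqxx. Qed.

Let lieD1 f1 f2 h : loop_lie (f1 + f2) h = loop_lie f1 h + loop_lie f2 h.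
Proof. by have := loop_lie_linearl h 1 f1 f2; rewrite !scale1r. Qed.
Let lieD2 f1 f2 h : loop_lie h (f1 + f2) = loop_lie h f1 + loop_lie h f2.
Proof. by have := loop_lie_linearr h 1 f1 f2; rewrite !scale1r. Qed.
Let lie01 h : loop_lie 0 h = 0.
Proof. by apply: (addrI (loop_lie 0 h)); rewrite -lieD1 !addr0. Qed.
Let lie02 h : loop_lie h 0 = 0.
Proof. by apply: (addrI (loop_lie h 0)); rewrite -lieD2 !addr0. Qed.

Lemma loop_ind (P : loop -> Prop) :
  P 0 -> (forall f h, P f -> P h -> P (f + h)) -> (forall x k, P (lmono x k)) ->
  forall f, P f.
Proof. by move=> P0 PD Pm f; rewrite [f]loopE; elim/big_ind: _. Qed.

Fact loop_liexx f : loop_lie f f = 0.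
Proof.
have anti u v : loop_lie u v = - loop_lie v u.
  elim/loop_ind: u => [|u1 u2 IH1 IH2|x i]; first by rewrite lie01 lie02 oppr0.
    by rewrite lieD1 lieD2 opprD IH1 IH2.
  elim/loop_ind: v => [|v1 v2 IH1 IH2|y j]; first by rewrite lie01 lie02 oppr0.
    by rewrite lieD1 lieD2 opprD IH1 IH2.
  rewrite !loop_lie_mono lie_antisym addrC.
  by apply/malgP => k; rewrite mcoeffN !lmono_coef mulNrn.
elim/loop_ind: f => [|u v IHu IHv|x k]; first exact: lie01.
  by rewrite lieD1 !lieD2 IHu IHv (anti v u) addr0 add0r subrr.
by rewrite loop_lie_mono liexx lmono0.
Qed.

Fact loop_lie_jacobi u v w :
  loop_lie u (loop_lie v w) + loop_lie v (loop_lie w u) + loop_lie w (loop_lie u v) = 0.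
Proof.
have addJ (a1 a2 b1 b2 c1 c2 : loop) : a1 + b1 + c1 = 0 -> a2 + b2 + c2 = 0 ->
    (a1 + a2) + (b1 + b2) + (c1 + c2) = 0.
  by move=> e1 e2; rewrite (addrACA a1) (addrACA (a1 + b1)) e1 e2 addr0.
elim/loop_ind: u => [|u1 u2 IH1 IH2|x i].
- by rewrite !(lie01, lie02) !addr0.
- by rewrite !(lieD1, lieD2); exact: addJ.
elim/loop_ind: v => [|v1 v2 IH1 IH2|y j].
- by rewrite !(lie01, lie02) !addr0.
- by rewrite !(lieD1, lieD2); exact: addJ.
elim/loop_ind: w => [|w1 w2 IH1 IH2|z k].
- by rewrite !(lie01, lie02) !addr0.
- by rewrite !(lieD1, lieD2); exact: addJ.
have jE : j + (k + i) = i + (j + k) by rewrite addrA addrC.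
have kE : k + (i + j) = i + (j + k) by rewrite addrC -addrA.
rewrite !loop_lie_mono jE kE; apply/malgP => m.
by rewrite !mcoeffD mcoeff0 !lmono_coef -!mulrnDl lie_jacobi mul0rn.
Qed.

HB.instance Definition _ := Lmodule_isLie.Build K loop
  loop_lie_linearl loop_lie_linearr loop_liexx loop_lie_jacobi.

Lemma lie_loopE f h : [Lie f, h] = loop_lie f h. Proof. by []. Qed.

End LoopTheory.

Section Cartan.
Variables (K : fieldType) (g : fdLieAlgType K).

Definition lie_simple : Prop :=
  (exists x y : g, [Lie x, y] <> 0) /\
  (forall J : {vspace g}, (forall x y, y \in J -> [Lie x, y] \in J) ->
     J = 0%VS \/ J = fullv).

Definition lie_prodv (U V : {vspace g}) : {vspace g} :=
  <<[seq [Lie x, y] | x <- vbasis U, y <- vbasis V]>>%VS.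

Definition lie_nilpotent (h : {vspace g}) : Prop :=
  exists n, iter n (lie_prodv h) h = 0%VS.

Definition is_cartan (h : {vspace g}) : Prop :=
  [/\ (lie_prodv h h <= h)%VS,
      lie_nilpotent h
    & forall x, (forall y, y \in h -> [Lie x, y] \in h) -> x \in h].

Definition dual (h : {vspace g}) := 'Hom(subvs_of h, K^o).
HB.instance Definition _ h := Vector.on (dual h).

Definition root_space (h : {vspace g}) (beta : dual h) (x : g) : Prop :=
  forall y : subvs_of h, [Lie vsval y, x] = (beta y : K) *: x.

Definition is_root (h : {vspace g}) (beta : dual h) : Prop :=
  beta <> 0 /\ exists2 x : g, x <> 0 & root_space beta x.

End Cartan.

(* v is a combination of the b i, i in J, with coefficients in nat. *)
Definition nat_comb (V : nmodType) (I : finType) (J : {pred I}) (b : I -> V) (v : V) : Prop :=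
  exists n : I -> nat, v = \sum_(i in J) b i *+ n i.

(* U is the linear span of the vectors satisfying P. *)
Definition is_vspan (K : fieldType) (V : vectType K) (P : V -> Prop) (U : {vspace V}) : Prop :=
  forall U' : {vspace V}, (U <= U')%VS <-> (forall x, P x -> x \in U').

(* A Cartan subalgebra, a basis (alpha i) of simple roots, the resulting
   triangular decomposition (nplus is the sum of the positive root spaces, nminus
   that of the negative ones), Chevalley generators X_i^+ = Xp i, X_i^- = Xm i,
   H_i = Hc i, and fundamental weights. Functionals on a subspace h of g are
   defined on subvs_of h, so that the value of beta at x \in h reads
   beta (vsproj h x). *)
Record chevalley (K : fieldType) (g : fdLieAlgType K) (I : finType) := Chevalley {
  cartan : {vspace g};
  cartanP : is_cartan cartan;
  alpha : I -> dual cartan;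
  alpha_basis : basis_of {:dual cartan} [seq alpha i | i : I];
  alpha_root : forall i, is_root (alpha i);
  root_alpha : forall beta : dual cartan, is_root beta ->
    nat_comb predT alpha beta \/ nat_comb predT alpha (- beta);
  nplus : {vspace g};
  nminus : {vspace g};
  nplusP : is_vspan
    (fun x => exists2 beta : dual cartan,
       is_root beta /\ nat_comb predT alpha beta & root_space beta x) nplus;
  nminusP : is_vspan
    (fun x => exists2 beta : dual cartan,
       is_root beta /\ nat_comb predT alpha (- beta) & root_space beta x) nminus;
  triangular : (nminus + cartan + nplus)%VS = fullv /\ directv (nminus + cartan + nplus);
  Xp : I -> g;
  Xm : I -> g;
  Hc : I -> g;
  Xp_root : forall i, root_space (alpha i) (Xp i);
  Xm_root : forall i, root_space (- alpha i) (Xm i);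
  Xp_Xm : forall i j, [Lie Xp i, Xm j] = if i == j then Hc i else 0;
  Hc_basis : basis_of cartan [seq Hc i | i : I];
  alpha_Hc : forall i, alpha i (vsproj cartan (Hc i)) = 2%:R;
  chevalley_gen : forall U : {vspace g},
    (forall x y, x \in U -> y \in U -> [Lie x, y] \in U) ->
    (forall i, Xp i \in U /\ Xm i \in U) -> U = fullv;
  omega : I -> dual cartan;
  omegaP : forall i j, omega i (vsproj cartan (Hc j)) = (i == j)%:R
}.

(* A diagram automorphism and a primitive m-th root of unity, where m is the
   order of the permutation of the simple roots; alpha_j(H_i) is the (i, j) entry
   of the Cartan matrix. *)
Record twisting (K : fieldType) (g : fdLieAlgType K) (I : finType)
    (C : chevalley g I) := Twisting {
  diag_perm : {perm I};
  diag_perm_cartan : forall i j,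
    alpha C (diag_perm j) (vsproj (cartan C) (Hc C (diag_perm i)))
    = alpha C j (vsproj (cartan C) (Hc C i));
  diag_aut : 'End(g);
  diag_aut_inj : lker diag_aut = 0%VS;
  diag_aut_lie : forall x y, diag_aut [Lie x, y] = [Lie diag_aut x, diag_aut y];
  diag_aut_Xp : forall i, diag_aut (Xp C i) = Xp C (diag_perm i);
  diag_aut_Xm : forall i, diag_aut (Xm C i) = Xm C (diag_perm i);
  diag_aut_Hc : forall i, diag_aut (Hc C i) = Hc C (diag_perm i);
  zeta : K;
  zeta_prim : (#[diag_perm]%g).-primitive_root zeta
}.

Lemma cartan_abelian (K : fieldType) (g : fdLieAlgType K) (I : finType)
  (C : chevalley g I) (x y : g) :
  x \in cartan C -> y \in cartan C -> [Lie x, y] = 0.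
Proof.
move=> xh yh; suff: (cartan C <= lker (linfun (lie x)))%VS.
  by move=> /subvP/(_ _ yh); rewrite memv_ker lfunE => /eqP.
rewrite -(span_basis (Hc_basis C)); apply/span_subvP => _ /imageP[i _ ->].
rewrite memv_ker lfunE /=; apply/eqP.
have <- : [Lie Xp C i, Xm C i] = Hc C i by rewrite Xp_Xm eqxx.
have := lie_jacobi x (Xp C i) (Xm C i); rewrite -addrA => /eqP.
rewrite addr_eq0 => /eqP ->; rewrite (lie_antisym _ x).
have xE : x = vsval (vsproj (cartan C) x) by rewrite vsprojK.
rewrite {1 2}xE Xp_root Xm_root opp_lfunE scaleNr opprK !lieZr.
by rewrite (lie_antisym (Xm C i)) scalerN subrr oppr0.
Qed.

Section TwistedLoop.
Variables (K : fieldType) (g : fdLieAlgType K) (I : finType) (C : chevalley g I).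
Variable T : twisting C.

Fact zeta_neq0 : zeta T != 0.
Proof.
apply/eqP => z0; have := prim_expr_order (zeta_prim T); rewrite z0 expr0n.
by rewrite (gtn_eqF (order_gt0 _)) => /esym/eqP; rewrite oner_eq0.
Qed.

Definition g0_pred : {pred g} := fun x => diag_aut T x == x.

Fact g0_pred_closed : submod_closed g0_pred.
Proof.
split; rewrite ?unfold_in; first by rewrite /g0_pred raddf0.
by move=> a x y /eqP xT /eqP yT; rewrite unfold_in /g0_pred linearP /= xT yT.
Qed.
HB.instance Definition _ := GRing.isSubmodClosed.Build K g g0_pred g0_pred_closed.

Fact g0_pred_lie : {in g0_pred &, forall x y, [Lie x, y] \in g0_pred}.
Proof.
by move=> x y /eqP xT /eqP yT; rewrite unfold_in /g0_pred diag_aut_lie xT yT.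
Qed.
HB.instance Definition _ := isLieClosed.Build K g g0_pred g0_pred_lie.

Definition g0 := subLie g0_pred.
HB.instance Definition _ := LieAlgebra.on g0.
HB.instance Definition _ := SubChoice.on g0.

Definition h0 : {vspace g} := (cartan C :&: fixedSpace (diag_aut T))%VS.

Definition res0 (beta : dual (cartan C)) : dual h0 :=
  linfun (beta \o vsproj (cartan C) \o vsval).

Lemma res0E beta x : res0 beta x = beta (vsproj (cartan C) (vsval x)).
Proof. by rewrite lfunE. Qed.

(* x \otimes t^k |-> sigma(x) \otimes zeta^k t^k *)
Definition loop_aut (f : loop g) : loop g :=
  loop_map (fun k x => zeta T ^ k *: diag_aut T x) f.

Lemma loop_autE f k : (loop_aut f)@_k = zeta T ^ k *: diag_aut T f@_k.
Proof. by rewrite loop_mapE // raddf0 scaler0. Qed.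

Fact loop_aut_linear : linear loop_aut.
Proof.
move=> a f h; apply/malgP => k.
rewrite mcoeffD loop_coefZ !loop_autE mcoeffD loop_coefZ linearP scalerDr.
by rewrite !scalerA mulrC.
Qed.
HB.instance Definition _ :=
  GRing.isLinear.Build K (loop g) (loop g) *:%R loop_aut loop_aut_linear.

Lemma loop_aut_mono x k : loop_aut (lmono x k) = lmono (zeta T ^ k *: diag_aut T x) k.
Proof.
apply/malgP => i; rewrite loop_autE !lmono_coef.
by case: eqP => [->|] //; rewrite raddf0 scaler0.
Qed.

Lemma loop_aut_lie f h : loop_aut [Lie f, h] = [Lie loop_aut f, loop_aut h].
Proof.
elim/loop_ind: f => [|f1 f2 IH1 IH2|x i].
- by rewrite lie0l !raddf0 lie0l.
- by rewrite lieDl !raddfD /= lieDl IH1 IH2.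
elim/loop_ind: h => [|f1 f2 IH1 IH2|y j].
- by rewrite lie0r !raddf0.
- by rewrite lieDr !raddfD /= IH1 IH2.
rewrite !loop_aut_mono !lie_loopE !loop_lie_mono loop_aut_mono diag_aut_lie lieZl lieZr scalerA.
by rewrite expfzDr ?zeta_neq0.
Qed.

(* L^Gamma(g) and L^Gamma(h), with the inclusions of L^Gamma(h) and of
   g_0 = g_0 \otimes 1 in L^Gamma(g). *)
Definition LG_pred : {pred loop g} := fun f => loop_aut f == f.

Fact LG_pred_closed : submod_closed LG_pred.
Proof.
split; rewrite ?unfold_in; first by rewrite /LG_pred raddf0.
by move=> a x y /eqP xT /eqP yT; rewrite unfold_in /LG_pred linearP /= xT yT.
Qed.
HB.instance Definition _ := GRing.isSubmodClosed.Build K (loop g) LG_pred LG_pred_closed.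

Fact LG_pred_lie : {in LG_pred &, forall x y, [Lie x, y] \in LG_pred}.
Proof.
by move=> x y /eqP xT /eqP yT; rewrite unfold_in /LG_pred loop_aut_lie xT yT.
Qed.
HB.instance Definition _ := isLieClosed.Build K (loop g) LG_pred LG_pred_lie.

Definition LG := subLie LG_pred.
HB.instance Definition _ := LieAlgebra.on LG.
HB.instance Definition _ := SubChoice.on LG.

Definition LGh_pred : {pred loop g} :=
  fun f => (f \in LG_pred) && (f \is a monalgOver (mem (cartan C))).

Lemma LGh_predP f :
  reflect (f \in LG_pred /\ forall k, f@_k \in cartan C) (f \in LGh_pred).
Proof.
rewrite unfold_in; apply: (iffP andP) => -[fL].
  by move=> /allP fh; split=> // k; case: msuppP => [/fh|_]; rewrite ?mem0v.
by move=> fh; split=> //; apply/allP => k _; exact: fh.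
Qed.

Fact LGh_pred_closed : submod_closed LGh_pred.
Proof.
split; first by apply/LGh_predP; split=> [|k]; rewrite ?rpred0 // mcoeff0 mem0v.
move=> a x y /LGh_predP[xL xh] /LGh_predP[yL yh]; apply/LGh_predP; split.
  by rewrite rpredD ?rpredZ.
by move=> k; rewrite mcoeffD loop_coefZ memvD ?memvZ.
Qed.
HB.instance Definition _ := GRing.isSubmodClosed.Build K (loop g) LGh_pred LGh_pred_closed.

Lemma LGh_abelian : {in LGh_pred &, forall x y, [Lie x, y] = 0}.
Proof.
move=> x y /LGh_predP[_ xh] /LGh_predP[_ yh]; rewrite lie_loopE.
rewrite loop_lie.unlock big1 // => i _; rewrite big1 // => j _.
by rewrite (cartan_abelian (xh i) (yh j)) lmono0.
Qed.

Fact LGh_pred_lie : {in LGh_pred &, forall x y, [Lie x, y] \in LGh_pred}.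
Proof. by move=> x y xh yh; rewrite LGh_abelian // rpred0. Qed.
HB.instance Definition _ := isLieClosed.Build K (loop g) LGh_pred LGh_pred_lie.

Definition LGh := subLie LGh_pred.
HB.instance Definition _ := LieAlgebra.on LGh.
HB.instance Definition _ := SubChoice.on LGh.

Fact LGh_lie_abelian (x y : LGh) : [Lie x, y] = 0.
Proof. by apply/val_inj; rewrite /= LGh_abelian // (valP x, valP y). Qed.
HB.instance Definition _ := LieAlgebra_isAbelian.Build K LGh LGh_lie_abelian.

Fact LGh_LG (x : LGh) : val x \in LG_pred.
Proof. by case/LGh_predP: (valP x). Qed.

Definition LGh_incl_fun (x : LGh) : LG := exist _ (val x) (LGh_LG x).
Fact LGh_incl_linear : linear LGh_incl_fun.
Proof. by move=> a x y; apply/val_inj. Qed.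
HB.instance Definition _ := GRing.isLinear.Build K LGh LG *:%R LGh_incl_fun LGh_incl_linear.
Fact LGh_incl_lie x y : LGh_incl_fun [Lie x, y] = [Lie LGh_incl_fun x, LGh_incl_fun y].
Proof. exact/val_inj. Qed.
Definition LGh_incl : lieHom LGh LG := LieHom (lieHom_fun := LGh_incl_fun) LGh_incl_lie.

Fact g0_LG (x : g0) : lmono (val x) 0 \in LG_pred.
Proof.
by rewrite unfold_in /LG_pred loop_aut_mono expr0z scale1r (eqP (valP x)).
Qed.
Definition g0_incl_fun (x : g0) : LG := exist _ (lmono (val x) 0) (g0_LG x).
Fact g0_incl_linear : linear g0_incl_fun.
Proof. by move=> a x y; apply/val_inj; rewrite /= lmono_linear. Qed.
HB.instance Definition _ := GRing.isLinear.Build K g0 LG *:%R g0_incl_fun g0_incl_linear.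
Fact g0_incl_lie x y : g0_incl_fun [Lie x, y] = [Lie g0_incl_fun x, g0_incl_fun y].
Proof. by apply/val_inj; rewrite /= [RHS]loop_lie_mono addr0. Qed.
Definition g0_incl : lieHom g0 LG := LieHom (lieHom_fun := g0_incl_fun) g0_incl_lie.

Definition Q0plus (I0 : {set I}) (beta : dual h0) : Prop :=
  nat_comb (mem I0) (fun i => res0 (alpha C i)) beta.
Definition P0plus (I0 : {set I}) (lambda : dual h0) : Prop :=
  nat_comb (mem I0) (fun i => res0 (omega C i)) lambda.

(* M is an L-module, seen as a g_0-module through f : g_0 -> L. *)
Definition weight_vector (L : lieAlgType K) (f : g0 -> L) (M : lmodType (env L))
    (mu : dual h0) (m : M) : Prop :=
  forall x : g0, val x \in cartan C ->
    envU L (f x) *: m = ((mu (vsproj h0 (val x)) : K)%:A : env L) *: m.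

(* Modules over a Lie algebra L are modules over the ring env L; scalars act
   through c%:A. *)
Definition highest_weight_vector (V : lmodType (env g0)) (lambda : dual h0) (v : V) : Prop :=
  [/\ v <> 0,
      forall x : g0, val x \in nplus C -> envU g0 x *: v = 0
    & weight_vector id lambda v].

Definition weyl_ind (V : lmodType (env g0)) := ext_scalars (env_map g0_incl) V.
HB.instance Definition _ V := GRing.Lmodule.on (weyl_ind V).

Definition weyl_rel (I0 : {set I}) (lambda : dual h0) (V : lmodType (env g0)) (m : weyl_ind V) : Prop :=
  exists2 mu : dual h0, ~ Q0plus I0 (lambda - mu) & weight_vector g0_incl mu m.

Definition global_weyl (I0 : {set I}) (lambda : dual h0) (V : lmodType (env g0)) :=
  lquot (submod_gen (weyl_rel I0 lambda (V := V))).
HB.instance Definition _ I0 lambda V := GRing.Lmodule.on (global_weyl I0 lambda V).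

Definition weyl_gen I0 lambda (V : lmodType (env g0)) (v : V) : global_weyl I0 lambda V :=
  lpi (submod_gen (weyl_rel I0 lambda (V := V))) (tens (env_map g0_incl) 1 v).

Definition weyl_alg I0 lambda (V : lmodType (env g0)) (v : V) :=
  ann_quot (env_map LGh_incl) (weyl_gen I0 lambda v).
HB.instance Definition _ I0 lambda V v := GRing.ComPzRing.on (@weyl_alg I0 lambda V v).

(* The projection U(L^Gamma(h)) -> A_lambda. *)
Definition weyl_alg_pi I0 lambda (V : lmodType (env g0)) (v : V) (a : env LGh) :
  weyl_alg I0 lambda v := annpi (env_map LGh_incl) (weyl_gen I0 lambda v) a.

End TwistedLoop.

Definition simple_lmod (R : pzRingType) (V : lmodType R) : Prop :=
  (exists v : V, v <> 0) /\
  (forall P : V -> Prop, P 0 -> (forall a u v, P u -> P v -> P (a *: u + v)) ->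
     (forall v, P v -> v = 0) \/ (forall v, P v)).

Definition fin_dim (K : fieldType) (A : algType K) (V : lmodType A) : Prop :=
  exists (n : nat) (e : 'I_n -> V), forall v, exists c : 'I_n -> K,
    v = \sum_i ((c i)%:A : A) *: e i.

Record right_module (A : pzRingType) (M : zmodType) := RightModule {
  rmul : M -> A -> M;
  rmulDl : forall a, {morph rmul^~ a : m n / m + n};
  rmulDr : forall m, {morph rmul m : a b / a + b};
  rmul1 : forall m, rmul m 1 = m;
  rmulM : forall m a b, rmul m (a * b) = rmul (rmul m a) b
}.

Definition finitely_generated (A : pzRingType) (M : zmodType) (act : right_module A M) : Prop :=
  exists (n : nat) (e : 'I_n -> M), forall m, exists a : 'I_n -> A,
    m = \sum_i rmul act (e i) (a i).

(* Main.v *)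
(* Let n^- be generated by the X_i^-, let w be the highest weight generator of W, and
   let A act on the right of W, commuting with U(L^Gamma(g)).

   Boundedness: grade W by the height of lambda - mu, which is read off from the
   eigenvalues of 2 rho^vee. The principal sl_2-triple (e, 2 rho^vee, f) lies in g_0,
   and f acts locally nilpotently on W because V is finite-dimensional and ad f is
   nilpotent on g. If u <> 0 has height d, the last nonzero f^k u is a lowest weight
   vector, whose eigenvalue c is a nonpositive integer, and e^{-c} f^k u <> 0 must
   have nonnegative height; this forces d <= lambda(2 rho^vee). So products of too
   many elements of L^Gamma(n^-) kill w.

   Finiteness: for simple i let y_k and x_k be the Gamma-orbit sums of X_i^- t^k and
   X_i^+ t^k, and let s = m or -m. Expanding (x_s)^N (y_0)^(N+1) w = 0 gives
   y_(sN) w = sum_(j<N) y_(sj) w a_j with a_j in A, and bracketing with L^Gamma(h)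
   translates all indices. So (y_k w) satisfies monic linear recurrences over A in
   both directions and spans a finitely generated A-module. The sequences with this
   property are stable under brackets, because the two recurrence polynomials
   multiply, so it passes to all of L^Gamma(n^-), then from w to words applied to w. *)

From HB Require Import structures.
Require Import Defs.
From mathcomp Require Import all_boot all_order all_fingroup all_algebra.
From mathcomp Require Import boolp finmap monalg zify ring.
From mathcomp Require Import reals.
From mathcomp.real_closed Require Import complex.

Set Implicit Arguments.
Unset Strict Implicit.
Unset Printing Implicit Defensive.

Import GRing.Theory.
Local Open Scope ring_scope.

(** * Linear algebra *)

Definition lin_closed (K : fieldType) (M : lmodType K) (Q : M -> Prop) : Prop :=
  Q 0 /\ (forall a x y, Q x -> Q y -> Q (a *: x + y)).

Section LinClosed.
Variables (K : fieldType) (M : lmodType K) (Q : M -> Prop).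
Hypothesis Qlin : lin_closed Q.

Lemma lin_closed0 : Q 0. Proof. by case: Qlin. Qed.

Lemma lin_closedD x y : Q x -> Q y -> Q (x + y).
Proof. by case: Qlin => _ /(_ 1) QD Qx Qy; rewrite -[x]scale1r; exact: QD. Qed.

Lemma lin_closedZ a x : Q x -> Q (a *: x).
Proof. by move=> Qx; rewrite -[_ *: _]addr0; case: Qlin => Q0 QD; exact: QD. Qed.

Lemma lin_closedN x : Q x -> Q (- x).
Proof. by rewrite -scaleN1r; exact: lin_closedZ. Qed.

Lemma lin_closedB x y : Q x -> Q y -> Q (x - y).
Proof. by move=> Qx Qy; apply: lin_closedD => //; exact: lin_closedN. Qed.

Lemma lin_closed_sum (J : Type) (r : seq J) (P : pred J) (F : J -> M) :
  (forall j, P j -> Q (F j)) -> Q (\sum_(j <- r | P j) F j).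
Proof. move=> QF; apply: (big_ind Q) => //; [exact: lin_closed0|exact: lin_closedD]. Qed.

Lemma lin_closed_span_of (G : M -> Prop) :
  (forall x, G x -> Q x) -> forall x, span_of G x -> Q x.
Proof.
move=> GQ x; elim=> [|y /GQ //|a y z _ Qy _ Qz]; first exact: lin_closed0.
by case: Qlin => _; exact.
Qed.

End LinClosed.

Lemma span_of_lin_closed (K : fieldType) (M : lmodType K) (G : M -> Prop) :
  lin_closed (span_of G).
Proof. by split=> [|a x y]; [exact: span_of0|exact: span_of_lin]. Qed.

Section FiniteGeneration.
Variables (K : fieldType) (U : vectType K).

(** Take a list of elements of [G] whose span has maximal dimension: one more element of [G] cannot
    enlarge it. *)
Lemma finite_span (G : U -> Prop) :
  exists s : seq U, (forall x, x \in s -> G x) /\ (forall x, G x -> x \in <<s>>%VS).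
Proof.
pose P n := `[< exists2 s : seq U, (forall x, x \in s -> G x) & \dim <<s>>%VS = n >].
have P0 : exists n, P n.
  by exists 0%N; apply/asboolP; exists [::]; rewrite // span_nil dimv0.
have Pb n : P n -> (n <= \dim {:U})%N.
  by move=> /asboolP[s _ <-]; rewrite dimvS // subvf.
case: (ex_maxnP P0 Pb) => n /asboolP[s sG dims] maxn.
exists s; split=> // x Gx; apply: contraT => xs.
have /maxn : P (\dim <<x :: s>>%VS).
  by apply/asboolP; exists (x :: s) => // y; rewrite inE => /predU1P[->|/sG].
rewrite -dims leqNgt => /negP[]; rewrite span_cons ltnNge; apply/negP => le.
have : (<<s>> == <[x]> + <<s>>)%VS by rewrite eqEdim addvSr le.
by move=> /eqP E; case/negP: xs; rewrite E; apply/subvP: (memv_line x); exact: addvSl.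
Qed.

Lemma vspace_of_lin_closed (Q : U -> Prop) :
  lin_closed Q -> exists W : {vspace U}, forall x, x \in W <-> Q x.
Proof.
move=> Qlin; have [s [sQ Qs]] := finite_span Q; exists <<s>>%VS => x; split=> [|/Qs //].
move=> xs; rewrite (coord_span (X := in_tuple s) xs); apply: (lin_closed_sum Qlin) => i _.
by apply: (lin_closedZ Qlin); apply: sQ; exact: mem_nth.
Qed.

Lemma mem_span_sum (s : seq U) x :
  x \in <<s>>%VS -> exists c : nat -> K, x = \sum_(i < size s) c i *: s`_i.
Proof.
move=> xs; exists (fun i => if insub i is Some j then coord (in_tuple s) j x else 0).
rewrite {1}(coord_span (X := in_tuple s) xs); apply: eq_bigr => i _.
by rewrite valK.
Qed.

End FiniteGeneration.

(** * Representations of Lie algebras *)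

(** Letting [L] act on a [K]-module, instead of using modules over [env L], makes the same lemmas
    serve the adjoint representation, [V] and the global Weyl module. *)
Record lieRep (K : fieldType) (L : lieAlgType K) (M : lmodType K) := LieRep {
  rep_act :> L -> M -> M;
  rep_linearl : forall m, linear (rep_act^~ m);
  rep_linearr : forall x, linear (rep_act x);
  rep_lie : forall x y m,
    rep_act [Lie x, y] m = rep_act x (rep_act y m) - rep_act y (rep_act x m)
}.

Section RepTheory.
Variables (K : fieldType) (L : lieAlgType K) (M : lmodType K) (r : lieRep L M).

HB.instance Definition _ x := GRing.isLinear.Build K M M *:%R (r x) (rep_linearr r x).

Definition rep_flip m x := r x m.
HB.instance Definition _ m :=
  GRing.isLinear.Build K L M *:%R (rep_flip m) (rep_linearl r m).

Lemma repDl x y m : r (x + y) m = r x m + r y m.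
Proof. exact: (raddfD (rep_flip m)). Qed.

Lemma rep0l m : r 0 m = 0.
Proof. exact: (raddf0 (rep_flip m)). Qed.

Lemma repZl a x m : r (a *: x) m = a *: r x m.
Proof. by rewrite -[LHS]/(rep_flip m (a *: x)) linearZ. Qed.

Lemma repNl x m : r (- x) m = - r x m.
Proof. exact: (raddfN (rep_flip m)). Qed.

Lemma repDr x m n : r x (m + n) = r x m + r x n.
Proof. exact: raddfD. Qed.

Lemma rep0r x : r x 0 = 0.
Proof. exact: raddf0. Qed.

Lemma repZr a x m : r x (a *: m) = a *: r x m.
Proof. exact: linearZ. Qed.

Lemma rep_sumr (J : Type) (s : seq J) (P : pred J) (F : J -> M) x :
  r x (\sum_(j <- s | P j) F j) = \sum_(j <- s | P j) r x (F j).
Proof. exact: raddf_sum. Qed.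

Lemma rep_suml (J : Type) (s : seq J) (P : pred J) (F : J -> L) m :
  r (\sum_(j <- s | P j) F j) m = \sum_(j <- s | P j) r (F j) m.
Proof. exact: (raddf_sum (rep_flip m)). Qed.

Lemma rep_swap x y m : r x (r y m) = r y (r x m) + r [Lie x, y] m.
Proof. by rewrite rep_lie addrC subrK. Qed.

Definition rep_nil (x : L) (m : M) : Prop := exists n, iter n (r x) m = 0.

Lemma iter_rep0 n x : iter n (r x) 0 = 0.
Proof. by elim: n => //= n ->; rewrite raddf0. Qed.

Lemma iter_rep_lin n x a u v :
  iter n (r x) (a *: u + v) = a *: iter n (r x) u + iter n (r x) v.
Proof. by elim: n => //= n ->; rewrite linearP. Qed.

Lemma iter_rep_le n k x m : iter n (r x) m = 0 -> (n <= k)%N -> iter k (r x) m = 0.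
Proof. by move=> E le; rewrite -(subnK le) iterD E iter_rep0. Qed.

Lemma rep_nil_lin_closed x : lin_closed (rep_nil x).
Proof.
split; first by exists 0%N.
move=> a u v [n En] [k Ek]; exists (maxn n k).
rewrite iter_rep_lin (iter_rep_le En) ?leq_maxl // (iter_rep_le Ek) ?leq_maxr //.
by rewrite scaler0 addr0.
Qed.

Lemma rep_nilS x m : rep_nil x (r x m) -> rep_nil x m.
Proof. by case=> n E; exists n.+1; rewrite iterSr. Qed.

(** Leibniz rule [f x m = x f m + [f, x] m], with a double induction on the exponents that kill [x]
    under [ad f] and [m] under [f]. *)
Lemma rep_nil_act f x m :
  (exists n, iter n (lie f) x = 0) -> rep_nil f m -> rep_nil f (r x m).
Proof.
case=> p Ep [q Eq].
elim: p q x m Ep Eq => [|p IHp] q x m Ep Eq.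
  by exists 0%N; rewrite /= in Ep *; rewrite Ep rep0l.
elim: q m Eq => [|q IHq] m Eq; first by exists 0%N; rewrite /= in Eq *; rewrite Eq raddf0.
apply: rep_nilS; rewrite rep_swap; apply: (lin_closedD (rep_nil_lin_closed f)).
  by apply: IHq; rewrite -iterSr.
by apply: (IHp q.+1) => //; rewrite -iterSr.
Qed.

Lemma rep_iter_weight h f kappa c m n :
  [Lie h, f] = - kappa *: f -> r h m = c *: m ->
  r h (iter n (r f) m) = (c - kappa *+ n) *: iter n (r f) m.
Proof.
move=> hf hm; elim: n => [|n IH] /=; first by rewrite subr0.
rewrite rep_swap IH linearZ /= hf repZl -scalerDl mulrSr opprD addrA; congr (_ *: _).
Qed.

(** [F] is the product of the operators [h - a]. When [s] lists all but one of several distinct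
    eigenvalues, it isolates the remaining eigenvector. *)
Lemma rep_eigen_prod (h : L) (s : seq K) :
  exists F : {linear M -> M}, forall b m, r h m = b *: m -> F m = (\prod_(a <- s) (b - a)) *: m.
Proof.
elim: s => [|a s [F FE]]; first by exists idfun => b m _; rewrite big_nil scale1r.
pose G := (fun m => r h m - a *: m : M).
have Glin : linear G.
  move=> c u v; rewrite /G linearP scalerDr !scalerA scalerBr scalerA mulrC.
  by rewrite opprD addrACA.
pose G' := GRing.isLinear.Build K M M *:%R G Glin.
pose GL : {linear M -> M} := HB.pack G G'.
exists (F \o GL) => b m hm /=; rewrite big_cons.
have -> : G m = (b - a) *: m by rewrite /G hm scalerBl.
by rewrite linearZ /= (FE b) // scalerA.
Qed.

Hypothesis char0 : forall n, n.+1%:R != 0 :> K.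

Lemma nat_scale_inj (a : K) n k : a != 0 -> a *+ n = a *+ k -> n = k.
Proof.
move=> a0; wlog le : n k / (n <= k)%N.
  by move=> W E; case/orP: (leq_total n k) => le; [exact: W|apply/esym/W].
move=> E; apply/eqP; rewrite eqn_leq le /= -subn_eq0; move/eqP: E.
rewrite eq_sym -subr_eq0 -mulrnBr //; case: (k - n)%N => // d.
by rewrite -mulr_natr mulf_eq0 (negPf a0) (negPf (char0 d)).
Qed.

(** The first [d.+1] iterates [f^n m] are linearly dependent, yet their [h]-eigenvalues
    [c - kappa n] are distinct; an iterate with nonzero coefficient in a dependence must therefore
    vanish. *)
Lemma rep_nil_findim (h f : L) kappa c m (d : nat) (e : 'I_d -> M) :
  (forall v, exists a : 'I_d -> K, v = \sum_i a i *: e i) ->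
  [Lie h, f] = - kappa *: f -> kappa != 0 -> r h m = c *: m -> rep_nil f m.
Proof.
move=> span hf k0 hm.
have /choice[a aE] : forall n : 'I_d.+1, exists a : 'I_d -> K,
    iter n (r f) m = \sum_i a i *: e i by move=> n; exact: span.
pose A := \matrix_(n < d.+1, i < d) a n i.
have kA : kermx A != 0.
  by rewrite -mxrank_eq0 mxrank_ker subn_eq0 -ltnNge ltnS rank_leq_col.
have [k /matrix0Pn[i [k0' uk]]] : exists k, row k (kermx A) != 0.
  case/matrix0Pn: kA => i [j nz]; exists i; apply/matrix0Pn.
  by exists 0, j; rewrite mxE.
move: uk; rewrite ord1; set u := row k _ => uk {i}.
have uA : u *m A = 0 by apply/sub_kermxP; exact: row_sub.
have dep : \sum_(n < d.+1) u 0 n *: iter n (r f) m = 0.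
  under eq_bigr => n _ do rewrite aE scaler_sumr.
  rewrite exchange_big big1 //= => j _.
  have uAj : \sum_(n < d.+1) u 0 n * a n j = 0.
    transitivity ((u *m A) 0 j); last by rewrite uA mxE.
    by rewrite [RHS]mxE; apply: eq_bigr => n _; rewrite [A n j]mxE.
  transitivity ((\sum_(n < d.+1) u 0 n * a n j) *: e j); last by rewrite uAj scale0r.
  by rewrite scaler_suml; apply: eq_bigr => n _; rewrite scalerA.
(* All eigenvalues except that of the iterate [k0']: the product operator kills every other term of
   [dep]. *)
pose s := [seq c - kappa *+ (n : 'I_d.+1) | n <- enum 'I_d.+1 & n != k0'].
have [F FE] := rep_eigen_prod h s; exists k0'; move/(congr1 F): dep.
rewrite raddf0 raddf_sum (bigD1 k0') //= big1 ?addr0 => [|n nk].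
  rewrite linearZ /= (FE _ _ (rep_iter_weight _ hf hm)) scalerA => /eqP.
  rewrite scaler_eq0 mulf_eq0 (negPf uk) /= => /orP[|/eqP //].
  rewrite prodf_seq_eq0 => /hasP[b /mapP[n]].
  rewrite mem_filter => /andP[nk _] -> /=.
  rewrite subr_eq0 => /eqP/addrI/oppr_inj E.
  by case/eqP: nk; apply/val_inj/esym; exact: nat_scale_inj k0 E.
rewrite linearZ /= (FE _ _ (rep_iter_weight _ hf hm)); apply/eqP; rewrite !scaler_eq0.
apply/orP; right; apply/orP; left; rewrite prodf_seq_eq0; apply/hasP.
exists (c - kappa *+ n); last by rewrite subrr eqxx.
by apply/mapP; exists n => //; rewrite mem_filter nk mem_enum.
Qed.

Variables (e f h : L) (kappa : K).
Hypotheses (ef : [Lie e, f] = h) (he : [Lie h, e] = kappa *: e).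

(** Moving [f] through the [n.+1] factors [e] leaves, up to sign, the sum of the weights
    [mu + kappa k] of [e^k u] for [k <= n]. *)
Lemma rep_lowest mu u n : r f u = 0 -> r h u = mu *: u ->
  r f (iter n.+1 (r e) u) = - (mu *+ n.+1 + kappa *+ 'C(n.+1, 2)) *: iter n (r e) u.
Proof.
move=> fu hu; have hn k : r h (iter k (r e) u) = (mu + kappa *+ k) *: iter k (r e) u.
  by rewrite (@rep_iter_weight h e (- kappa) mu) ?opprK // mulNrn opprK.
have fe x : r f (r e x) = r e (r f x) - r h x.
  by rewrite rep_swap lie_antisym ef repNl.
elim: n => [|n IH]; first by rewrite /= fe fu raddf0 hu sub0r -scaleNr bin_small // mulr0n addr0.
rewrite [iter n.+2 _ _]iterS fe hn IH repZr -scalerBl; congr (_ *: _).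
rewrite ['C(n.+2, 2)]binS bin1 [mu *+ n.+2]mulrSr (mulrnDr kappa 'C(n.+1, 2)) -opprD; congr (- _).
by rewrite addrACA.
Qed.

(** Choose [k] last with [f^k m] nonzero, then [j] last with [e^j f^k m] nonzero; applying [f] to
    [e^(j+1) f^k m = 0] gives the identity. The value [kappa = 0] is allowed and covers Heisenberg
    triples. *)
Lemma rep_lowest_weight mu m : [Lie h, f] = - kappa *: f -> r h m = mu *: m -> m != 0 ->
  rep_nil f m ->
  (forall k, let u := iter k (r f) m in exists j, iter j (r e) u = 0) ->
  exists k j, [/\ iter k (r f) m != 0, iter j (r e) (iter k (r f) m) != 0
                & (mu - kappa *+ k) *+ j.+1 + kappa *+ 'C(j.+1, 2) = 0].
Proof.
move=> hf hm m0 [n0 /eqP nil] enil.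
have ex : exists n, iter n (r f) m == 0 by exists n0.
case: (ex_minnP ex) => -[|k] /eqP fk mink; first by rewrite /= in fk; rewrite fk eqxx in m0.
have uk : iter k (r f) m != 0 by apply/negP => /mink; rewrite ltnn.
have [j0 /eqP Ej0] := enil k; have exj : exists j, iter j (r e) (iter k (r f) m) == 0 by exists j0.
case: (ex_minnP exj) => -[|j] /eqP ej minj; first by rewrite /= in ej; rewrite ej eqxx in uk.
have uj : iter j (r e) (iter k (r f) m) != 0 by apply/negP => /minj; rewrite ltnn.
exists k, j; split=> //; have := rep_lowest j fk (rep_iter_weight k hf hm).
by rewrite ej raddf0 => /esym/eqP; rewrite scaler_eq0 oppr_eq0 (negPf uj) orbF => /eqP.
Qed.

End RepTheory.

(** * Generation of g by its Chevalley generators *)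

Lemma lie_deriv (K : fieldType) (L : lieAlgType K) (x y z : L) :
  [Lie x, [Lie y, z]] = [Lie [Lie x, y], z] + [Lie y, [Lie x, z]].
Proof.
have /eqP := lie_jacobi x y z; rewrite -addrA addr_eq0 => /eqP ->.
by rewrite opprD addrC (lie_antisym z [Lie x, y]) opprK (lie_antisym z x) lieNr opprK.
Qed.

Definition adjoint_rep (K : fieldType) (L : lieAlgType K) : lieRep L L.
Proof.
apply: (@LieRep K L L (@lie K L)) => [m|x|x y m]; [exact: lie_linearl|exact: lie_linearr|].
by rewrite [X in _ = X - _]lie_deriv addrK.
Defined.

Lemma mem_span_image (K : fieldType) (U : vectType K) (J : finType) (F : J -> U) x :
  x \in <<[seq F j | j : J]>>%VS -> exists c : J -> K, x = \sum_j c j *: F j.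
Proof.
have Qlin : lin_closed (fun x => exists c : J -> K, x = \sum_j c j *: F j).
  split=> [|a _ _ [c ->] [d ->]].
    by exists (fun=> 0); rewrite big1 // => j _; rewrite scale0r.
  exists (fun j => a * c j + d j); rewrite scaler_sumr -big_split.
  by apply: eq_bigr => j _; rewrite scalerDl scalerA.
have [W WQ] := vspace_of_lin_closed Qlin; move=> xF; apply/WQ.
apply: subvP x xF; apply/span_subvP => _ /imageP[j _ ->]; apply/WQ.
exists (fun i => (i == j)%:R); rewrite (bigD1 j) //= eqxx scale1r big1 ?addr0 // => i.
by move/negPf->; rewrite scale0r.
Qed.

Lemma free_image (K : fieldType) (U : vectType K) (J : finType) (F : J -> U) (c : J -> K) :
  free [seq F j | j : J] -> \sum_j c j *: F j = 0 -> forall j, c j = 0.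
Proof.
move=> fF E j; rewrite -(enum_rankK j); move: (enum_rank j) => {j}.
have /freeP := fF : free [tuple of image F predT]; apply.
rewrite -[RHS]E (reindex (@enum_rank J)) /=; last first.
  by exists (@enum_val J J) => i _; rewrite ?enum_rankK ?enum_valK.
by apply: eq_bigr => i _; rewrite enum_rankK nth_image enum_rankK.
Qed.

Section LieGen.
Variables (K : fieldType) (L : lieAlgType K) (I : Type).

(** Bracket monomials. For the letters [X_i^+] or [X_i^-] their span plays the role of n^+ or n^-,
    with induction on monomials at hand. *)
Inductive lie_gen (X : I -> L) : L -> Prop :=
| lie_gen_in i : lie_gen X (X i)
| lie_gen_lie x y : lie_gen X x -> lie_gen X y -> lie_gen X [Lie x, y].

Lemma span_of_lie (G : L -> Prop) (Q : L -> Prop) :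
  lin_closed Q -> (forall x y, G x -> G y -> Q [Lie x, y]) ->
  forall x y, span_of G x -> span_of G y -> Q [Lie x, y].
Proof.
move=> Qlin QG x y Gx Gy.
apply: (lin_closed_span_of (Q := fun x => Q [Lie x, y])) Gx => [|{}x Gx].
  split=> [|a u v Qu Qv]; first by rewrite lie0l; exact: lin_closed0.
  by rewrite lieDl lieZl; case: Qlin => _; exact.
apply: (lin_closed_span_of (Q := fun y => Q [Lie x, y])) Gy => [|{}y Gy]; last exact: QG.
split=> [|a u v Qu Qv]; first by rewrite lie0r; exact: lin_closed0.
by rewrite lieDr lieZr; case: Qlin => _; exact.
Qed.

Lemma lie_gen_span_lie (X : I -> L) x y :
  span_of (lie_gen X) x -> span_of (lie_gen X) y -> span_of (lie_gen X) [Lie x, y].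
Proof.
apply: span_of_lie; first exact: span_of_lin_closed.
by move=> {}x {}y Xx Xy; apply: span_of_gen; exact: lie_gen_lie.
Qed.

Variables (X Y : I -> L) (h : L -> Prop).
Hypothesis hY : forall i x, h x -> exists c, [Lie x, Y i] = c *: Y i.
Hypothesis XY : forall i j, h [Lie X i, Y j].

Lemma lie_gen_torus x y : h x -> lie_gen Y y -> span_of (lie_gen Y) [Lie x, y].
Proof.
move=> hx; elim=> [i|{}y z Yy IHy Yz IHz].
  have [c ->] := hY i hx; rewrite -[_ *: _]addr0.
  by apply: span_of_lin; [apply: span_of_gen; exact: lie_gen_in|exact: span_of0].
rewrite lie_deriv; apply: (lin_closedD (span_of_lin_closed _)); apply: lie_gen_span_lie => //;
  exact: span_of_gen.
Qed.

(** The derivation rule brings [X i] to a single letter, where the bracket falls into [h]; [h] in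
    turn maps monomials to their span. This is the inclusion of [[X_i, n^-]] in [n^- + h]. *)
Lemma lie_gen_opposite i y :
  lie_gen Y y -> span_of (fun z => lie_gen Y z \/ h z) [Lie X i, y].
Proof.
have SY z : span_of (lie_gen Y) z -> span_of (fun z => lie_gen Y z \/ h z) z.
  apply: lin_closed_span_of; first exact: span_of_lin_closed.
  by move=> {}z Yz; apply: span_of_gen; left.
have Sl z u : span_of (fun z => lie_gen Y z \/ h z) z -> lie_gen Y u ->
    span_of (lie_gen Y) [Lie z, u].
  move=> Sz Yu; move: Sz; apply: (lin_closed_span_of (Q := fun z => span_of _ [Lie z, u])).
    split=> [|a v w Qu Qv]; first by rewrite lie0l; exact: span_of0.
    by rewrite lieDl lieZl; exact: span_of_lin.
  move=> v [Yv|hv]; last exact: lie_gen_torus.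
  by apply: span_of_gen; exact: lie_gen_lie.
elim=> [j|{}y z Yy IHy Yz IHz]; first by apply: span_of_gen; right.
rewrite lie_deriv; apply: SY; apply: (lin_closedD (span_of_lin_closed _)); first exact: Sl.
by rewrite lie_antisym; apply: (lin_closedN (span_of_lin_closed _)); exact: Sl.
Qed.

End LieGen.

Section Chevalley.
Variables (K : fieldType) (g : fdLieAlgType K) (I : finType) (C : chevalley g I).
Local Notation h := (cartan C).

(* alpha_i x, for x \in h; outside h, vsproj first projects x to h. *)
Definition av i (x : g) : K := alpha C i (vsproj h x).

Lemma av_linear i : linear (av i : g -> K^o).
Proof. by move=> a x y; rewrite /av !linearP. Qed.
HB.instance Definition _ i := GRing.isLinear.Build K g K^o *:%R (av i : g -> K^o) (av_linear i).

Lemma avZ i a x : av i (a *: x) = a * av i x.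
Proof. by rewrite /av linearZ /= linearZ. Qed.

Lemma lie_gen_full (Q : g -> Prop) :
  lin_closed Q -> (forall x y, Q x -> Q y -> Q [Lie x, y]) ->
  (forall i, Q (Xp C i)) -> (forall i, Q (Xm C i)) -> forall x, Q x.
Proof.
move=> Qlin Qlie Qp Qm x; have [U UQ] := vspace_of_lin_closed Qlin.
apply/UQ; rewrite (@chevalley_gen _ _ _ C U) ?memvf //.
  by move=> {}x y /UQ Qx /UQ Qy; apply/UQ; exact: Qlie.
by move=> i; split; apply/UQ.
Qed.

Lemma root_spaceE (beta : dual h) x y : root_space beta x -> y \in h ->
  [Lie y, x] = (beta (vsproj h y) : K) *: x.
Proof. by move=> bx yh; rewrite -bx vsprojK. Qed.

Lemma Xp_weight i y : y \in h -> [Lie y, Xp C i] = av i y *: Xp C i.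
Proof. exact: (root_spaceE (@Xp_root _ _ _ C i)). Qed.

Lemma Xm_weight i y : y \in h -> [Lie y, Xm C i] = - av i y *: Xm C i.
Proof. by move/(root_spaceE (@Xm_root _ _ _ C i)); rewrite opp_lfunE. Qed.

Lemma Hc_mem i : Hc C i \in h.
Proof. by apply: (basis_mem (Hc_basis C)); exact: map_f (mem_enum _ _). Qed.

Lemma cartan_span x : x \in h -> exists c : I -> K, x = \sum_i c i *: Hc C i.
Proof. by rewrite -(span_basis (Hc_basis C)); exact: mem_span_image. Qed.

Lemma Hc_free (c : I -> K) : \sum_i c i *: Hc C i = 0 -> forall i, c i = 0.
Proof. exact: free_image (basis_free (Hc_basis C)). Qed.

(** The simple roots span the dual of the Cartan subalgebra, so every coordinate functional vanishes
    at [x]. *)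
Lemma cartan_eq0 x : x \in h -> (forall i, av i x = 0) -> x = 0.
Proof.
move=> xh x0; have phi0 (phi : dual h) : phi (vsproj h x) = 0.
  have : phi \in <<[seq alpha C i | i : I]>>%VS by rewrite (span_basis (alpha_basis C)) memvf.
  case/mem_span_image => c ->; rewrite sum_lfunE big1 // => i _.
  by rewrite scale_lfunE -[alpha C i _]/(av i x) x0 scaler0.
rewrite -(vsprojK xh); have -> : vsproj h x = 0; last by rewrite raddf0.
rewrite (coord_vbasis (memvf (vsproj h x))) big1 // => i _.
have := phi0 (linfun (coord (vbasis fullv) i : subvs_of h -> K^o)).
by rewrite lfunE /= => ->; rewrite scale0r.
Qed.

(** The matrix of the [alpha_i(H_j)] is invertible: a kernel vector gives a combination of the [H_j]
    killed by all simple roots, hence zero. This supplies the fundamental coweights and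
    [2 rho^vee]. *)
Lemma coweight (c : I -> K) : exists2 x, x \in h & forall i, av i x = c i.
Proof.
pose A := \matrix_(k < #|I|, l < #|I|) av (enum_val l) (Hc C (enum_val k)).
pose xi (u : 'rV_#|I|) := \sum_i u 0 (enum_rank i) *: Hc C i.
have xih u : xi u \in h by rewrite memv_suml // => i _; rewrite memvZ ?Hc_mem.
have avxi u i : av i (xi u) = (u *m A) 0 (enum_rank i).
  rewrite raddf_sum mxE (reindex (@enum_rank I)) /=; last first.
    by exists (@enum_val I I) => j _; rewrite ?enum_rankK ?enum_valK.
  by apply: eq_bigr => j _; rewrite linearZ mxE !enum_rankK.
have Aunit : A \in unitmx.
  rewrite -row_free_unit -kermx_eq0; apply/eqP/row_matrixP => k; rewrite row0.
  apply/rowP => l; rewrite [RHS]mxE; set u := row k _.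
  have uA : u *m A = 0 by apply/sub_kermxP; exact: row_sub.
  have /Hc_free/(_ (enum_val l)) : xi u = 0.
    by apply: cartan_eq0 => // i; rewrite avxi uA mxE.
  by rewrite enum_valK.
exists (xi ((\row_l c (enum_val l)) *m invmx A)) => // i.
by rewrite avxi mulmxKV // mxE enum_rankK.
Qed.

(** The span [S] of the three kinds of elements is a subalgebra containing the Chevalley generators,
    hence everything. *)
Lemma chevalley_ind (Q : g -> Prop) : lin_closed Q ->
  (forall x, lie_gen (Xm C) x -> Q x) -> (forall x, x \in h -> Q x) ->
  (forall x, lie_gen (Xp C) x -> Q x) -> forall x, Q x.
Proof.
move=> Qlin Qm Qh Qp x.
pose S := span_of (fun x => [\/ lie_gen (Xm C) x, x \in h | lie_gen (Xp C) x]).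
suff : S x by apply: lin_closed_span_of => // y [/Qm|/Qh|/Qp].
have Slin : lin_closed S by exact: span_of_lin_closed.
have hXm i y : y \in h -> exists c, [Lie y, Xm C i] = c *: Xm C i.
  by move=> yh; exists (- av i y); exact: Xm_weight.
have hXp i y : y \in h -> exists c, [Lie y, Xp C i] = c *: Xp C i.
  by move=> yh; exists (av i y); exact: Xp_weight.
have Sm : forall y, lie_gen (Xm C) y -> S y by move=> y ?; apply: span_of_gen; constructor 1.
have Sh : forall y, y \in h -> S y by move=> y ?; apply: span_of_gen; constructor 2.
have Sp : forall y, lie_gen (Xp C) y -> S y by move=> y ?; apply: span_of_gen; constructor 3.
have pm i j : [Lie Xp C i, Xm C j] \in h by rewrite Xp_Xm; case: eqP; rewrite ?mem0v ?Hc_mem.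
have mp i j : [Lie Xm C i, Xp C j] \in h by rewrite lie_antisym memvN.
have adlin y : lin_closed (fun z => S [Lie y, z]).
  split=> [|a u v Su Sv]; first by rewrite lie0r; exact: lin_closed0.
  by rewrite lieDr lieZr; case: Slin => _; exact.
(* The elements whose adjoint action preserves [S] form a subalgebra, so only the generators have to
   be checked. *)
have adS y : S y -> forall z, S z -> S [Lie y, z].
  move=> _; move: y; apply: lie_gen_full => [|y z Sy Sz u Su|i|i].
  - split=> [z _|a u v Su Sv z Sz]; first by rewrite lie0l; exact: lin_closed0.
    by rewrite lieDl lieZl; case: Slin => _; apply; [exact: Su|exact: Sv].
  - rewrite (_ : [Lie [Lie y, z], u] = [Lie y, [Lie z, u]] - [Lie z, [Lie y, u]]).
      by apply: (lin_closedB Slin); [apply/Sy/Sz|apply/Sz/Sy].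
    by rewrite lie_deriv addrK.
  - apply: lin_closed_span_of; first exact: adlin.
    move=> z [zm|zh|zp].
    + apply: (lin_closed_span_of Slin)
        (lie_gen_opposite (h := fun y => y \in h) hXm pm i zm).
      by move=> y [/Sm|/Sh].
    + rewrite lie_antisym Xp_weight //.
      exact/(lin_closedN Slin)/(lin_closedZ Slin)/Sp/lie_gen_in.
    + by apply/Sp/lie_gen_lie => //; exact: lie_gen_in.
  - apply: lin_closed_span_of; first exact: adlin.
    move=> z [zm|zh|zp].
    + by apply/Sm/lie_gen_lie => //; exact: lie_gen_in.
    + rewrite lie_antisym Xm_weight //.
      exact/(lin_closedN Slin)/(lin_closedZ Slin)/Sm/lie_gen_in.
    + apply: (lin_closed_span_of Slin)
        (lie_gen_opposite (h := fun y => y \in h) hXp mp i zp).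
      by move=> y [/Sp|/Sh].
apply: lie_gen_full => // [y z Sy Sz|i|i]; [exact: adS|exact/Sp/lie_gen_in|exact/Sm/lie_gen_in].
Qed.

Lemma root_space_lie (beta gamma : dual h) x y :
  root_space beta x -> root_space gamma y -> root_space (beta + gamma) [Lie x, y].
Proof.
move=> bx cy z; rewrite lie_deriv bx cy lieZl lieZr add_lfunE -scalerDl; congr (_ *: _).
Qed.

(** The factor [n.+1] is the number of letters of the monomial; its positivity makes n^+ and n^-
    strictly graded by [z]. *)
Lemma lie_gen_weight (X : I -> g) (a : I -> dual h) (z : subvs_of h) (c : K) x :
  (forall i, root_space (a i) (X i)) -> (forall i, a i z = c) -> lie_gen X x ->
  exists (beta : dual h) (n : nat), [/\ root_space beta x & beta z = c *+ n.+1].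
Proof.
move=> aX az; elim=> [i|{}x y _ [b [n [bx bn]]] _ [b' [k [by_ bk]]]].
  by exists (a i), 0%N; split.
exists (b + b'), (n + k).+1; split; first exact: root_space_lie.
by rewrite add_lfunE bn bk -mulrnDr addSn addnS.
Qed.

Section Diagram.
Variable T : twisting C.
Local Notation sg := (diag_aut T).
Local Notation pi := (diag_perm T).

Lemma diag_aut_cartan x : x \in h -> sg x \in h.
Proof.
case/cartan_span => c ->; rewrite raddf_sum memv_suml // => i _.
by rewrite /= linearZ /= memvZ // diag_aut_Hc Hc_mem.
Qed.

Lemma av_diag i x : x \in h -> av (pi i) (sg x) = av i x.
Proof.
case/cartan_span => c ->; rewrite !raddf_sum; apply: eq_bigr => j _.
by rewrite /= linearZ /= !avZ diag_aut_Hc; congr (_ * _); exact: diag_perm_cartan.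
Qed.

Lemma lie_gen_diag (X : I -> g) x : (forall i, sg (X i) = X (pi i)) ->
  lie_gen X x -> lie_gen X (sg x).
Proof.
move=> sX; elim=> [i|{}x y _ Xx _ Xy]; first by rewrite sX; exact: lie_gen_in.
by rewrite diag_aut_lie; exact: lie_gen_lie.
Qed.

Lemma iter_diag_aut_lin n a x y :
  iter n sg (a *: x + y) = a *: iter n sg x + iter n sg y.
Proof. by elim: n => //= n ->; rewrite linearP. Qed.

Lemma iter_diag_autZ n a x : iter n sg (a *: x) = a *: iter n sg x.
Proof. by elim: n => //= n ->; rewrite linearZ. Qed.

Lemma iter_diag_aut_lie n x y : iter n sg [Lie x, y] = [Lie iter n sg x, iter n sg y].
Proof. by elim: n => //= n ->; rewrite diag_aut_lie. Qed.

Lemma iter_diag_autX (X : I -> g) n i : (forall i, sg (X i) = X (pi i)) ->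
  iter n sg (X i) = X ((pi ^+ n)%g i).
Proof.
move=> sX; elim: n => [|n IH] /=; first by rewrite expg0 perm1.
by rewrite IH sX expgSr permM.
Qed.

Lemma iter_diag_aut_order x : iter #[pi]%g sg x = x.
Proof.
move: x; apply: lie_gen_full => [|x y Ex Ey|i|i].
- split=> [|a x y Ex Ey]; last by rewrite iter_diag_aut_lin Ex Ey.
  by elim: (#[pi]%g) => //= n ->; rewrite raddf0.
- by rewrite iter_diag_aut_lie Ex Ey.
- by rewrite (iter_diag_autX _ _ (diag_aut_Xp T)) expg_order perm1.
- by rewrite (iter_diag_autX _ _ (diag_aut_Xm T)) expg_order perm1.
Qed.

End Diagram.
End Chevalley.

(** * Diagram automorphisms and twisted loop elements *)

(** Translation invariance of a sum over Z/m, written on the representatives 0, ..., m-1. *)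
Lemma sum_period (V : nmodType) (m : nat) (F : nat -> V) :
  (forall s, F (s + m)%N = F s) -> forall u, \sum_(s < m) F (u + s)%N = \sum_(s < m) F s.
Proof.
case: m => [|m] Fm; first by move=> u; rewrite !big_ord0.
elim=> [//|u IH]; rewrite -IH big_ord_recr [RHS]big_ord_recl /= addrC addn0.
congr (_ + _); first by rewrite -(Fm u) addnS addSn.
by apply: eq_bigr => i _; rewrite /bump /= addnA addn1.
Qed.

Section DiagramSl2.
Variables (K : fieldType) (g : fdLieAlgType K) (I : finType) (C : chevalley g I).
Variable T : twisting C.
Hypothesis char0 : forall n, n.+1%:R != 0 :> K.

Local Notation h := (cartan C).
Local Notation sg := (diag_aut T).
Local Notation pi := (diag_perm T).
Local Notation m := (#[diag_perm T]%g).

(** Bracket monomials and Cartan elements span g and are eigenvectors of [z]; [x] shifts eigenvalues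
    by a nonzero amount and g is finite-dimensional. *)
Lemma ad_nil (z x : g) c kappa y : z \in h -> (forall i, av C i z = c) ->
  [Lie z, x] = - kappa *: x -> kappa != 0 -> rep_nil (adjoint_rep g) x y.
Proof.
move=> zh zc zx k0; pose r := adjoint_rep g.
have nil b u : [Lie z, u] = b *: u -> rep_nil r x u.
  move=> zu.
  apply: (@rep_nil_findim _ _ _ r char0 z x kappa b u _ (fun i => (vbasis {:g})`_i)) => //.
  by move=> v; exists (fun i => coord (vbasis {:g}) i v); rewrite {1}(coord_vbasis (memvf v)).
move: y; apply: (chevalley_ind (C := C)) => [|u um|u uh|u up].
- exact: rep_nil_lin_closed.
- have [|beta [n [bu _]]] := lie_gen_weight (z := vsproj h z) (c := - c) (@Xm_root _ _ _ C) _ um.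
    by move=> i; rewrite opp_lfunE; congr (- _); exact: zc.
  by apply: nil; rewrite (root_spaceE bu).
- by apply: (nil 0); rewrite (cartan_abelian zh) // scale0r.
- have [|beta [n [bu _]]] := lie_gen_weight (z := vsproj h z) (c := c) (@Xp_root _ _ _ C) _ up.
    exact: zc.
  by apply: nil; rewrite (root_spaceE bu).
Qed.

Lemma cartan_ext x y : x \in h -> y \in h -> (forall i, av C i x = av C i y) -> x = y.
Proof.
move=> xh yh E; apply/eqP; rewrite -subr_eq0; apply/eqP/(cartan_eq0 (C := C)).
  by rewrite memvB.
by move=> i; rewrite (raddfB (av C i : g -> K^o)) /= E subrr.
Qed.

Lemma diag_fixed (c : I -> K) x : x \in h -> (forall i, av C i x = c i) ->
  (forall i, c (pi i) = c i) -> sg x = x.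
Proof.
move=> xh xc cpi; apply: cartan_ext => // [|i]; first exact: diag_aut_cartan.
by rewrite -(permKV pi i) av_diag // !xc cpi.
Qed.

(** Here [z] is [2 rho^vee], and the [c i] are its coordinates in the basis of the [H_i]. *)
Lemma principal_sl2 z : z \in h -> (forall i, av C i z = 2%:R) ->
  exists c : I -> K, let e := \sum_i Xp C i in let f := \sum_i c i *: Xm C i in
  [/\ sg e = e, sg f = f, [Lie e, f] = z, [Lie z, e] = 2%:R *: e & [Lie z, f] = - 2%:R *: f].
Proof.
move=> zh z2; have sz : sg z = z by apply: (diag_fixed zh z2).
have [c cE] := cartan_span zh.
(* Since [sg z = z] and the [H_j] are independent, [c] is constant on orbits; this puts [f] in
   g_0. *)
have cpi i : c (pi i) = c i.
  have E : \sum_j (c j - c ((pi^-1)%g j)) *: Hc C j = 0.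
    under eq_bigr => j _ do rewrite scalerBl.
    rewrite sumrB -cE [X in _ - X](reindex_perm pi) /=.
    rewrite -[X in X - _]sz {1}cE raddf_sum -sumrB big1 // => j _.
    by rewrite /= linearZ /= diag_aut_Hc permK subrr.
  by have /eqP := Hc_free E (pi i); rewrite permK subr_eq0 => /eqP.
exists c; split.
- rewrite raddf_sum [RHS](reindex_perm pi); apply: eq_bigr => i _ /=.
  by rewrite diag_aut_Xp.
- rewrite raddf_sum [RHS](reindex_perm pi); apply: eq_bigr => i _ /=.
  by rewrite linearZ /= diag_aut_Xm cpi.
- rewrite lie_suml cE; apply: eq_bigr => i _; rewrite lie_sumr (bigD1 i) //= big1 => [|j ji].
    by rewrite lieZr Xp_Xm eqxx addr0.
  by rewrite lieZr Xp_Xm eq_sym (negPf ji) scaler0.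
- by rewrite lie_sumr scaler_sumr; apply: eq_bigr => i _; rewrite Xp_weight // z2.
- rewrite lie_sumr scaler_sumr; apply: eq_bigr => i _.
  by rewrite lieZr Xm_weight // z2 !scalerA mulrC.
Qed.

(** The order of the stabilizer of [i] in the group generated by [pi]. It appears as a multiplicity
    in brackets of orbit sums. *)
Definition stab_order (i : I) : nat := \sum_(s < m) ((pi ^+ s)%g i == i).

Lemma stab_order_neq0 i : (stab_order i)%:R != 0 :> K.
Proof.
rewrite /stab_order; case: (m) (order_gt0 pi) => // n _.
by rewrite big_ord_recl /= expg0 perm1 eqxx add1n.
Qed.

Lemma expg_period s i : (pi ^+ (s + m))%g i = (pi ^+ s)%g i.
Proof. by rewrite expgD expg_order mulg1. Qed.

Lemma av_iter_diag n i x : x \in h -> av C ((pi ^+ n)%g i) (iter n sg x) = av C i x.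
Proof.
elim: n => [|n IH] xh /=; first by rewrite expg0 perm1.
rewrite expgSr permM av_diag ?IH //.
by elim: n {IH} => //= n; exact: diag_aut_cartan.
Qed.

(* Otherwise the orbit sums of X_i^+ and X_i^- would span a Heisenberg algebra
   whose centre acts semisimply on g; as they act nilpotently, it acts by 0. *)
Lemma orbit_cartan_neq0 i : \sum_(s < m) av C i (Hc C ((pi ^+ s)%g i)) != 0.
Proof.
set kappa := \sum_(s < m) _; apply/eqP => k0.
pose orb s := (pi ^+ s)%g i.
pose E := \sum_(s < m) Xp C (orb s); pose F := \sum_(s < m) Xm C (orb s).
pose q := stab_order i; pose z := q%:R *: \sum_(s < m) Hc C (orb s).
have orbD s u : (orb s == orb (s + u)%N) = ((pi ^+ u)%g i == i).
  by rewrite /orb addnC expgD permM (inj_eq perm_inj) eq_sym.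
have zh : z \in h by rewrite memvZ // memv_suml // => s _; exact: Hc_mem.
have EF : [Lie E, F] = z.
  rewrite /z lie_suml scaler_sumr; apply: eq_bigr => s _; rewrite lie_sumr.
  under eq_bigr => u _ do rewrite Xp_Xm.
  (* After shifting the inner sum by [s], the two indices coincide exactly for [u] in the stabilizer
     of [i], whence the factor [q]. *)
  rewrite -(sum_period (F := fun u => if orb s == orb u then Hc C (orb s) else 0) _ s) => [|u].
    under eq_bigr => u _ do rewrite orbD.
    rewrite /q /stab_order natr_sum scaler_suml; apply: eq_bigr => u _.
    by case: eqP => _; rewrite ?scale1r ?scale0r.
  by rewrite /orb expg_period.
have sz : sg z = z.
  rewrite /z linearZ /=; congr (_ *: _).
  transitivity (\sum_(s < m) Hc C (orb (1 + s)%N)).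
    by rewrite raddf_sum; apply: eq_bigr => s _; rewrite /= diag_aut_Hc /orb expgSr permM.
  apply: (sum_period (F := fun s => Hc C (orb s))) => s; by rewrite /orb expg_period.
have avz s : av C (orb s) z = 0.
  have -> : z = iter s sg z by elim: s => //= s <-; rewrite sz.
  rewrite av_iter_diag //  /z avZ (raddf_sum (av C i : g -> K^o)) /=.
  by rewrite -[X in _ * X]/kappa k0 mulr0.
have zE : [Lie z, E] = 0 *: E.
  by rewrite lie_sumr scale0r big1 // => s _; rewrite Xp_weight // avz scale0r.
have zF : [Lie z, F] = - 0 *: F.
  by rewrite lie_sumr oppr0 scale0r big1 // => s _; rewrite Xm_weight // avz oppr0 scale0r.
have [z2 z2h z2c] := coweight C (fun=> 1).
have nilE y : rep_nil (adjoint_rep g) E y.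
  apply: (@ad_nil z2 E 1 (- 1) y z2h z2c); last by rewrite oppr_eq0 oner_eq0.
  by rewrite opprK scale1r lie_sumr; apply: eq_bigr => s _; rewrite Xp_weight // z2c scale1r.
have nilF y : rep_nil (adjoint_rep g) F y.
  apply: (@ad_nil z2 F 1 1 y z2h z2c); last exact: oner_neq0.
  by rewrite lie_sumr scaler_sumr; apply: eq_bigr => s _; rewrite Xm_weight // z2c.
have Xp0 j : Xp C j != 0.
  apply/eqP => Xj; have := Xp_Xm C j j; rewrite eqxx Xj lie0l => Hj.
  have : \sum_i (i == j)%:R *: Hc C i = 0.
    by rewrite (bigD1 j) //= big1 ?eqxx ?scale1r -?Hj ?addr0 // => k /negPf->; rewrite scale0r.
  by move/Hc_free/(_ j)/eqP; rewrite eqxx oner_eq0.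
have z0 : z = 0.
  apply: (cartan_eq0 zh) => j.
  (* With [kappa = 0] the lowest weight identity for the vector [X_j^+] reads
     [alpha_j(z) (n+1) = 0]. *)
  have [k [n [_ _ /eqP]]] := @rep_lowest_weight _ _ _ (adjoint_rep g) E F z 0 EF zE (av C j z)
    (Xp C j) zF (Xp_weight j zh) (Xp0 j) (nilF _) (fun k => nilE _).
  by rewrite !mul0rn subr0 addr0 -mulr_natr mulf_eq0 (negPf (char0 n)) orbF => /eqP.
(* The coefficient of [H_i] in [z] is [q * q], which is nonzero in characteristic 0. *)
have : \sum_j (q%:R * (\sum_(s < m) (orb s == j))%:R) *: Hc C j = 0.
  transitivity z; last exact: z0.
  rewrite /z scaler_sumr.
  under eq_bigr => j _ do rewrite [X in _ * X]natr_sum mulr_sumr scaler_suml.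
  rewrite exchange_big; apply: eq_bigr => s _; rewrite (bigD1 (orb s)) //= big1 => [|j].
    by rewrite eqxx mulr1 addr0.
  by rewrite eq_sym => /negPf->; rewrite mulr0 scale0r.
move/Hc_free/(_ i)/eqP; rewrite mulf_eq0 -[X in _ || (X%:R == 0)]/q orbb.
exact/negP/stab_order_neq0.
Qed.

End DiagramSl2.

(** * Orbit sums in the twisted loop algebra *)

Section TwistedSum.
Variables (K : fieldType) (g : fdLieAlgType K) (I : finType) (C : chevalley g I).
Variable T : twisting C.
Hypothesis char0 : forall n, n.+1%:R != 0 :> K.

Local Notation h := (cartan C).
Local Notation sg := (diag_aut T).
Local Notation pi := (diag_perm T).
Local Notation m := (#[diag_perm T]%g).
Local Notation zeta := (zeta T).

(** This is [m] times the projection of [x] to the eigenspace of sigma for [zeta^(-k)]. *)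
Definition isotypic (k : int) (x : g) : g := \sum_(s < m) zeta ^ (k * s%:Z) *: iter s sg x.

Lemma isotypic_lin k a x y : isotypic k (a *: x + y) = a *: isotypic k x + isotypic k y.
Proof.
rewrite /isotypic scaler_sumr -big_split; apply: eq_bigr => s _.
by rewrite iter_diag_aut_lin scalerDr !scalerA mulrC.
Qed.

Lemma zeta_order k : zeta ^ (k * m%:Z) = 1.
Proof. by rewrite mulrC -exprz_exp -exprnP prim_expr_order ?exp1rz //; exact: zeta_prim. Qed.

Lemma zetaD j k : zeta ^ (j + k) = zeta ^ j * zeta ^ k.
Proof. by rewrite expfzDr // zeta_neq0. Qed.

Lemma isotypic_period k x s : zeta ^ (k * (s + m)%N%:Z) *: iter (s + m) sg x
  = zeta ^ (k * s%:Z) *: iter s sg x.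
Proof. by rewrite PoszD mulrDr zetaD zeta_order mulr1 iterD iter_diag_aut_order. Qed.

Lemma isotypic_diag k x : zeta ^ k *: sg (isotypic k x) = isotypic k x.
Proof.
rewrite raddf_sum scaler_sumr -[RHS](sum_period (isotypic_period k x) 1).
apply: eq_bigr => s _; rewrite /= linearZ /= scalerA -zetaD; congr (zeta ^ _ *: _).
by rewrite PoszD mulrDr mulr1.
Qed.

Fact tw_LG x k : lmono (isotypic k x) k \in LG_pred T.
Proof. by rewrite unfold_in /LG_pred loop_aut_mono isotypic_diag. Qed.

(* The sum of the Gamma-orbit of x \otimes t^k. *)
Definition tw (x : g) (k : int) : LG T := exist _ (lmono (isotypic k x) k) (tw_LG x k).

Definition tw_at k x := tw x k.

Lemma tw_linear k : linear (tw_at k).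
Proof. by move=> a x y; apply/val_inj; rewrite /= isotypic_lin lmono_linear. Qed.
HB.instance Definition _ k := GRing.isLinear.Build K g (LG T) *:%R (tw_at k) (tw_linear k).

Lemma tw_sum (J : Type) (r : seq J) (P : pred J) (F : J -> g) k :
  tw (\sum_(j <- r | P j) F j) k = \sum_(j <- r | P j) tw (F j) k.
Proof. exact: (raddf_sum (tw_at k)). Qed.

Lemma twZ a x k : tw (a *: x) k = a *: tw x k.
Proof. by rewrite -[LHS]/(tw_at k (a *: x)) linearZ. Qed.

Lemma twD x y k : tw (x + y) k = tw x k + tw y k.
Proof. exact: (raddfD (tw_at k)). Qed.

Lemma tw0 k : tw 0 k = 0.
Proof. exact: (raddf0 (tw_at k)). Qed.

Lemma val_LG_sum (J : Type) (r : seq J) (P : pred J) (F : J -> LG T) :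
  val (\sum_(j <- r | P j) F j) = \sum_(j <- r | P j) val (F j).
Proof. exact: raddf_sum. Qed.

Lemma lmono_sum (J : Type) (r : seq J) (P : pred J) (F : J -> g) k :
  lmono (\sum_(j <- r | P j) F j) k = \sum_(j <- r | P j) lmono (F j) k.
Proof.
elim/big_rec2: _ => [|j y z _ <-]; first exact: lmono0.
by have := lmono_linear k 1 (F j) z; rewrite !scale1r.
Qed.

Lemma lmonoZ a (x : g) k : lmono (a *: x) k = a *: lmono x k.
Proof. by have := lmono_linear k a x 0; rewrite lmono0 !addr0. Qed.

(** The double sum over Gamma is reindexed by the relative position [s] of the two factors; the
    other index rebuilds an orbit sum. *)
Lemma tw_lie x y j k :
  [Lie tw x j, tw y k] = \sum_(s < m) zeta ^ (k * s%:Z) *: tw [Lie x, iter s sg y] (j + k).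
Proof.
apply/val_inj; rewrite val_LG_sum /= [LHS]loop_lie_mono.
under [RHS]eq_bigr => s _ do rewrite /= -lmonoZ.
rewrite -lmono_sum; congr lmono; rewrite /isotypic lie_suml.
transitivity (\sum_(u < m) \sum_(s < m)
    zeta ^ (j * u%:Z) * zeta ^ (k * (u + s)%N%:Z) *: [Lie iter u sg x, iter (u + s) sg y]).
  apply: eq_bigr => u _; rewrite lieZl lie_sumr scaler_sumr.
  under [RHS]eq_bigr => s _ do rewrite -scalerA -lieZr.
  rewrite -!scaler_sumr -!lie_sumr; congr (_ *: [Lie _, _]).
  by rewrite -[LHS](sum_period (isotypic_period k y) u).
rewrite exchange_big; apply: eq_bigr => s _; rewrite scaler_sumr; apply: eq_bigr => u _.
rewrite iter_diag_aut_lie -iterD scalerA -!zetaD; congr (zeta ^ _ *: _).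
by rewrite PoszD mulrDr mulrDl addrA addrC.
Qed.

Lemma order_neq0 : m%:R != 0 :> K.
Proof. by case: (m) (order_gt0 pi). Qed.

(** Orthogonality of characters: [c + d] runs over all residues modulo [m], and for [0 < s < m] the
    geometric sum of the powers of [zeta^s] vanishes. *)
Lemma sum_zeta_pow d s : (s < m)%N ->
  \sum_(c < m) zeta ^ ((c%:Z + d) * s%:Z) = (s == 0)%:R * m%:R.
Proof.
move=> sm; have zE (c : nat) : zeta ^ ((c%:Z + d) * s%:Z) = zeta ^ (d * s%:Z) * (zeta ^+ s) ^+ c.
  by rewrite mulrDl zetaD mulrC; congr (_ * _); rewrite mulrC -exprz_exp -!exprnP.
under eq_bigr => c _ do rewrite zE; rewrite -mulr_sumr.
case: (posnP s) => [->|s0].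
  rewrite mulr0 expr0z mul1r mul1r expr0; under eq_bigr => c _ do rewrite expr1n.
  by rewrite sumr_const card_ord.
have : zeta ^+ s - 1 != 0.
  rewrite subr_eq0 -(expr0 zeta) (eq_prim_root_expr (zeta_prim T)) mod0n modn_small //.
  by rewrite -lt0n.
rewrite mulr0n mul0r => /mulfI z1; rewrite (_ : \sum_(c < m) _ = 0) ?mulr0 //.
apply: z1; rewrite -subrX1 mulr0 exprAC (prim_expr_order (zeta_prim T)) expr1n subrr //.
Qed.

(* Fourier inversion over Gamma separates the summands of tw_lie. *)
Lemma tw_lie_separate x y n d :
  m%:R *: tw [Lie x, y] (n + d) = \sum_(c < m) [Lie tw x (n - c%:Z), tw y (c%:Z + d)].
Proof.
under eq_bigr => c _ do rewrite tw_lie addrA subrK.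
rewrite exchange_big /=; under eq_bigr => s _ do rewrite -scaler_suml sum_zeta_pow //.
case: (m) (order_gt0 pi) => // k _; rewrite big_ord_recl big1 /= ?addr0 ?mul1r // => s _.
by rewrite mul0r scale0r.
Qed.

(** A fixed loop with coefficients [f_k] satisfies [m f = sum_k tw f_k k], and [m] is invertible, so
    the orbit sums span. *)
Lemma tw_ind (Q : LG T -> Prop) : lin_closed Q -> (forall x k, Q (tw x k)) -> forall f, Q f.
Proof.
move=> Qlin Qtw f; rewrite -[f]scale1r -(mulVf order_neq0) -scalerA.
apply: (lin_closedZ Qlin).
rewrite (_ : _ *: f = \sum_(k <- monalg.msupp (val f)) tw (monalg.mcoeff k (val f)) k); last first.
  apply/val_inj; rewrite val_LG_sum /= {1}[val f]loopE scaler_sumr; apply: eq_bigr => k _.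
  have fk : zeta ^ k *: sg (monalg.mcoeff k (val f)) = monalg.mcoeff k (val f).
    by rewrite -loop_autE (eqP (valP f)).
  have fks s : zeta ^ (k * s%:Z) *: iter s sg (monalg.mcoeff k (val f)) = monalg.mcoeff k (val f).
    elim: s => [|s IH]; first by rewrite mulr0 expr0z scale1r.
    rewrite -[RHS]fk -{2}IH linearZ /= scalerA -zetaD; congr (zeta ^ _ *: _).
    by rewrite -addn1 PoszD mulrDr mulr1 addrC.
  rewrite -lmonoZ; congr lmono; rewrite /isotypic; under eq_bigr => s _ do rewrite fks.
  by rewrite sumr_const card_ord scaler_nat.
by apply: (lin_closed_sum Qlin) => k _.
Qed.

Lemma tw_LGh x k : x \in h -> exists a : LGh T, LGh_incl T a = tw x k.
Proof.
move=> xh; have iterh s : iter s sg x \in h.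
  by elim: s => //= s; exact: diag_aut_cartan.
have LGhx : val (tw x k) \in LGh_pred T.
  apply/LGh_predP; split; first exact: valP.
  move=> j; rewrite /= lmono_coef; apply: rpredMn; apply: memv_suml => s _.
  by rewrite memvZ.
by exists (exist (fun f => f \in LGh_pred T) _ LGhx); apply/val_inj.
Qed.

Lemma iter_g0 (y : g0 T) s : iter s sg (val y) = val y.
Proof. by elim: s => //= s ->; exact: (eqP (valP y)). Qed.

Lemma g0_lie_tw (y : g0 T) x k : [Lie g0_incl T y, tw x k] = tw [Lie val y, x] k.
Proof.
apply/val_inj; rewrite /= [LHS]loop_lie_mono add0r; congr lmono.
rewrite lie_sumr; apply: eq_bigr => s _.
by rewrite iter_diag_aut_lie iter_g0 lieZr.
Qed.

Lemma tw_g0 (y : g0 T) : tw (val y) 0 = m%:R *: g0_incl T y.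
Proof.
apply/val_inj; rewrite /= -lmonoZ; congr lmono; rewrite /isotypic.
under eq_bigr => s _ do rewrite iter_g0 mul0r expr0z scale1r.
by rewrite sumr_const card_ord scaler_nat.
Qed.

End TwistedSum.

(** * Right actions of a commutative ring and recurrent sequences *)

(** [ract_scalar] makes the field act through [R]; with commutativity of [R] this gives
    [K]-linearity of the right action. *)
Record rightAction (R : comNzRingType) (K : fieldType) (M : lmodType K) := RightAction {
  ract :> M -> R -> M;
  ractDl : forall a, {morph ract^~ a : u v / u + v};
  ractDr : forall u, {morph ract u : a b / a + b};
  ract1 : forall u, ract u 1 = u;
  ractM : forall u a b, ract u (a * b) = ract (ract u a) b;
  ract_scalar : K -> R;
  ract_scalarE : forall u c, ract u (ract_scalar c) = c *: u
}.

Section RightAction.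
Variables (R : comNzRingType) (K : fieldType) (M : lmodType K) (ra : rightAction R M).

Lemma ract0l a : ra 0 a = 0.
Proof. by apply: (addrI (ra 0 a)); rewrite -ractDl !addr0. Qed.

Lemma ract0r u : ra u 0 = 0.
Proof. by apply: (addrI (ra u 0)); rewrite -ractDr !addr0. Qed.

Lemma ractC u a b : ra (ra u a) b = ra (ra u b) a.
Proof. by rewrite -!ractM mulrC. Qed.

Lemma ractZl c u a : ra (c *: u) a = c *: ra u a.
Proof. by rewrite -!(ract_scalarE ra) ractC. Qed.

Lemma ractNl u a : ra (- u) a = - ra u a.
Proof. by rewrite -scaleN1r ractZl scaleN1r. Qed.

Lemma ractN1 u : ra u (-1) = - u.
Proof. by apply/eqP; rewrite -addr_eq0 -{2}[u](ract1 ra) -ractDr addNr ract0r. Qed.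

Lemma ract_suml (J : Type) (s : seq J) (P : pred J) (F : J -> M) a :
  ra (\sum_(j <- s | P j) F j) a = \sum_(j <- s | P j) ra (F j) a.
Proof. exact: (big_morph (ra^~ a) (ractDl ra a) (ract0l a)). Qed.

Inductive rspan (G : M -> Prop) : M -> Prop :=
| rspan0 : rspan G 0
| rspan_in u a v : G u -> rspan G v -> rspan G (ra u a + v).

Lemma rspan_gen (G : M -> Prop) u : G u -> rspan G u.
Proof. by move=> Gu; rewrite -[u](ract1 ra) -[ra _ _]addr0; exact: rspan_in (rspan0 _). Qed.

Lemma rspanD (G : M -> Prop) u v : rspan G u -> rspan G v -> rspan G (u + v).
Proof.
by elim=> [|x a y Gx _ IH] Gv; rewrite ?add0r // -addrA; apply: rspan_in => //; exact: IH.
Qed.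

Lemma rspan_ract (G : M -> Prop) u a : rspan G u -> rspan G (ra u a).
Proof.
elim=> [|x b y Gx _ IH]; first by rewrite ract0l; exact: rspan0.
by rewrite ractDl -ractM; exact: rspan_in.
Qed.

Lemma rspan_lin_closed (G : M -> Prop) : lin_closed (rspan G).
Proof.
split=> [|c u v Gu Gv]; first exact: rspan0.
by apply: rspanD => //; rewrite -(ract_scalarE ra); exact: rspan_ract.
Qed.

Lemma rspan_sub (G H : M -> Prop) : (forall u, G u -> rspan H u) ->
  forall u, rspan G u -> rspan H u.
Proof.
move=> GH u; elim=> [|x a y /GH Hx _ IH]; first exact: rspan0.
by apply: rspanD => //; exact: rspan_ract.
Qed.

Lemma rspan_seq (s : seq M) u : rspan (fun x => x \in s) u ->
  exists a : 'I_(size s) -> R, u = \sum_(i < size s) ra s`_i (a i).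
Proof.
elim=> [|x b v xs _ [a ->]]; first by exists (fun=> 0); rewrite big1 // => i _; rewrite ract0r.
have xi : (index x s < size s)%N by rewrite index_mem.
exists (fun i => (if i == Ordinal xi then b else 0) + a i).
under [RHS]eq_bigr => i _ do rewrite ractDr.
rewrite big_split; congr (_ + _).
rewrite (bigD1 (Ordinal xi)) //= eqxx nth_index // big1 ?addr0 // => i.
by move=> /negPf->; rewrite ract0r.
Qed.

End RightAction.

(** * Polynomials in the shift operator acting on sequences *)

Section PolyShift.
Variables (R : comNzRingType) (K : fieldType) (M : lmodType K) (ra : rightAction R M).
Variable delta : int.
Implicit Types (P Q : {poly R}) (u v : int -> M).

(* P evaluated at the shift by delta of sequences indexed by int. *)
Definition shift_poly P u (n : int) : M := \sum_(j < size P) ra (u (n + delta * j%:Z)) P`_j.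

Lemma shift_poly_widen P u n k : (size P <= k)%N ->
  shift_poly P u n = \sum_(j < k) ra (u (n + delta * j%:Z)) P`_j.
Proof.
move=> le; rewrite /shift_poly (big_ord_widen k (fun j => ra (u (n + delta * j%:Z)) P`_j)) //.
rewrite big_mkcond; apply: eq_bigr => j _; case: ltnP => // Pj.
by rewrite nth_default // ract0r.
Qed.

Lemma shift_polyD P Q u n : shift_poly (P + Q) u n = shift_poly P u n + shift_poly Q u n.
Proof.
pose k := maxn (size P) (size Q).
rewrite !(@shift_poly_widen _ _ _ k) ?leq_maxl ?leq_maxr ?size_polyD //.
by rewrite -big_split; apply: eq_bigr => j _; rewrite coefD ractDr.
Qed.

Lemma shift_polyCM a P u n : shift_poly (a%:P * P) u n = ra (shift_poly P u n) a.
Proof.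
rewrite (@shift_poly_widen _ _ _ (size P)); last by rewrite mul_polyC size_scale_leq.
rewrite ract_suml; apply: eq_bigr => j _.
by rewrite coefCM [a * _]mulrC ractM.
Qed.

Lemma shift_polyMX P u n : shift_poly (P * 'X) u n = shift_poly P u (n + delta).
Proof.
rewrite (@shift_poly_widen _ _ _ (size P).+1); last first.
  by rewrite (leq_trans (size_polyMleq _ _)) // size_polyX addn2.
rewrite big_ord_recl coefMX /= ract0r add0r; apply: eq_bigr => j _.
rewrite coefMX /=; congr (ra (u _) _).
by rewrite /bump /= PoszD mulrDr mulr1 addrA.
Qed.

Lemma eq_shift_poly P u v n : (forall k, u k = v k) -> shift_poly P u n = shift_poly P v n.
Proof. by move=> E; apply: eq_bigr => j _; rewrite E. Qed.

Lemma shift_poly_translate P u k n :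
  shift_poly P (fun i => u (i + k)) n = shift_poly P u (n + k).
Proof. by apply: eq_bigr => j _; rewrite addrAC. Qed.

(** ['X] acts as the shift, so products act as compositions; as [R] is commutative, [P * Q] kills
    every sequence killed by [P] or by [Q]. *)
Lemma shift_polyM P Q u n : shift_poly (P * Q) u n = shift_poly P (shift_poly Q u) n.
Proof.
elim/poly_ind: P Q n => [|P a IH] Q n; first by rewrite mul0r /shift_poly size_poly0 !big_ord0.
rewrite mulrDl !shift_polyD; congr (_ + _).
  rewrite -mulrA ['X * _]mulrC IH shift_polyMX.
  by rewrite (eq_shift_poly _ _ (shift_polyMX Q u)) shift_poly_translate.
rewrite shift_polyCM -[a%:P in RHS]mulr1 shift_polyCM.
by rewrite /shift_poly size_poly1 big_ord1 coef1 ract1 mulr0 addr0.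
Qed.

Lemma shift_poly_seqD P u v n :
  shift_poly P (fun k => u k + v k) n = shift_poly P u n + shift_poly P v n.
Proof. by rewrite -big_split; apply: eq_bigr => j _; rewrite ractDl. Qed.

Lemma shift_poly_seqZ P c u n : shift_poly P (fun k => c *: u k) n = c *: shift_poly P u n.
Proof. by rewrite scaler_sumr; apply: eq_bigr => j _; rewrite ractZl. Qed.

Lemma shift_poly_seq0 P n : shift_poly P (fun=> 0) n = 0.
Proof. by rewrite /shift_poly big1 // => j _; rewrite ract0l. Qed.

Lemma shift_poly_seq_sum P (J : finType) (F : J -> int -> M) n :
  shift_poly P (fun k => \sum_j F j k) n = \sum_j shift_poly P (F j) n.
Proof. by rewrite exchange_big; apply: eq_bigr => j _; rewrite ract_suml. Qed.

(** [delta] may be negative: a monic recurrence only determines terms in the direction of [delta],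
    and finite generation needs both directions. *)
Definition recurrent u : Prop := exists2 P, P \is monic & forall n, shift_poly P u n = 0.

Lemma eq_recurrent u v : (forall k, u k = v k) -> recurrent u -> recurrent v.
Proof.
move=> E [P Pm Pu]; exists P => // n; rewrite -(Pu n); apply: eq_shift_poly => k.
by rewrite E.
Qed.

Lemma recurrent0 : recurrent (fun=> 0).
Proof. by exists 1; [exact: monic1|exact: shift_poly_seq0]. Qed.

Lemma recurrentD u v : recurrent u -> recurrent v -> recurrent (fun n => u n + v n).
Proof.
move=> [P Pm Pu] [Q Qm Qv]; exists (P * Q); first by rewrite rpredM.
move=> n; rewrite shift_poly_seqD [in X in X + _]mulrC !shift_polyM.
by rewrite (eq_shift_poly _ _ Pu) (eq_shift_poly _ _ Qv) !shift_poly_seq0 addr0.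
Qed.

Lemma recurrentZ c u : recurrent u -> recurrent (fun n => c *: u n).
Proof. by move=> [P Pm Pu]; exists P => // n; rewrite shift_poly_seqZ Pu scaler0. Qed.

Lemma recurrent_translate k u : recurrent u -> recurrent (fun n => u (n + k)).
Proof. by move=> [P Pm Pu]; exists P => // n; rewrite shift_poly_translate. Qed.

Lemma recurrent_sum (J : finType) (F : J -> int -> M) :
  (forall j, recurrent (F j)) -> recurrent (fun n => \sum_j F j n).
Proof.
move=> RF; suff Rs s : recurrent (fun n => \sum_(j <- s) F j n).
  by apply: eq_recurrent (Rs (index_enum J)) => k.
elim: s => [|j s IH]; first by apply: eq_recurrent recurrent0 => k; rewrite big_nil.
by apply: eq_recurrent (recurrentD (RF j) IH) => k; rewrite big_cons.
Qed.

Lemma recurrent_step u : recurrent u ->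
  exists d : nat, forall n, exists a : 'I_d -> R,
    u (n + delta * d%:Z) = \sum_(j < d) ra (u (n + delta * j%:Z)) (a j).
Proof.
move=> [P Pm Pu]; exists (size P).-1 => n; exists (fun j => - P`_j).
have := Pu n; rewrite /shift_poly -(prednK (n := size P)); last first.
  by rewrite lt0n size_poly_eq0 monic_neq0.
rewrite big_ord_recr /= (monicP Pm : P`_(size P).-1 = 1) ract1 addrC => /eqP.
rewrite addr_eq0 => /eqP ->; rewrite -sumrN; apply: eq_bigr => j _.
by rewrite -[- P`_j]mulrN1 ractM ractN1.
Qed.

End PolyShift.

Lemma recurrent_finite (R : comNzRingType) (K : fieldType) (M : lmodType K)
    (ra : rightAction R M) (k : nat) (u : int -> M) : (0 < k)%N ->
  recurrent ra k%:Z u -> recurrent ra (- k%:Z) u ->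
  exists js : seq int, forall n, rspan ra (fun x => exists2 j, j \in js & x = u j) (u n).
Proof.
move=> k0 /recurrent_step[d1 E1] /recurrent_step[d2 E2].
(* As [D] bounds [k * d1] and [k * d2], one of the recurrences expresses any term outside [-D, D]
   through indices of smaller absolute value. *)
pose D := (k * maxn d1 d2)%N.
exists [seq n%:Z - D%:Z | n <- iota 0 (D + D).+1] => n.
have [b] := ubnP `|n|%N; elim: b n => // b IH n nb.
have [nD|Dn] := leqP `|n|%N D.
  apply: rspan_gen; exists n => //; apply/mapP; exists (absz (n + D%:Z)); last by lia.
  by rewrite mem_iota; lia.
have [n0|n0] : 0 <= n \/ n < 0 by lia.
  have [a] := E1 (n - k%:Z * d1%:Z); rewrite subrK => ->.
  apply: (lin_closed_sum (rspan_lin_closed _ _)) => j _; apply/rspan_ract/IH.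
  have jd := ltn_ord j; have : (k * d1 <= D)%N by rewrite leq_mul2l leq_maxl orbT.
  have : (k * j < k * d1)%N by rewrite ltn_pmul2l.
  have := leq0n (k * j); rewrite -!PoszM; lia.
have [a] := E2 (n + k%:Z * d2%:Z); rewrite mulNr addrK => ->.
apply: (lin_closed_sum (rspan_lin_closed _ _)) => j _; apply/rspan_ract/IH.
have jd := ltn_ord j; have : (k * d2 <= D)%N by rewrite leq_mul2l leq_maxr orbT.
have : (k * j < k * d2)%N by rewrite ltn_pmul2l.
have := leq0n (k * j); rewrite mulNr -!PoszM; lia.
Qed.

(** * Garland's relation *)

Section Garland.
Variables (K : fieldType) (L : lieAlgType K) (M : lmodType K) (r : lieRep L M).
Variables (R : comNzRingType) (ra : rightAction R M).
Hypothesis char0 : forall n, n.+1%:R != 0 :> K.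
Hypothesis ra_rep : forall x u a, r x (ra u a) = ra (r x u) a.
Variables (E : L) (Y H : nat -> L) (w : M) (eta : nat -> R) (kappa : K).
Hypotheses (EY : forall j, [Lie E, Y j] = H j.+1)
  (HY : forall i j, [Lie H i, Y j] = - kappa *: Y (i + j)%N).
Hypotheses (Ew : r E w = 0) (Hw : forall i, r (H i) w = ra w (eta i)).

Definition Yword (s : seq nat) : M := foldr (fun j => r (Y j)) w s.

(* m is c times words in the Y j, of length n and total degree d, modulo words of
   length n and smaller degree. *)
Inductive garland_form (n d : nat) : K -> M -> Prop :=
| garland0 : garland_form n d 0 0
| garland_word s : size s = n -> sumn s = d -> garland_form n d 1 (Yword s)
| garland_low s a : size s = n -> (sumn s < d)%N -> garland_form n d 0 (ra (Yword s) a)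
| garland_lin a c1 c2 m1 m2 : garland_form n d c1 m1 -> garland_form n d c2 m2 ->
    garland_form n d (a * c1 + c2) (a *: m1 + m2).

Lemma garlandD n d c1 c2 m1 m2 : garland_form n d c1 m1 -> garland_form n d c2 m2 ->
  garland_form n d (c1 + c2) (m1 + m2).
Proof. by move=> g1 g2; have := garland_lin 1 g1 g2; rewrite mul1r scale1r. Qed.

Lemma garlandZ n d a c m : garland_form n d c m -> garland_form n d (a * c) (a *: m).
Proof. by move=> g; have := garland_lin a g (garland0 n d); rewrite !addr0. Qed.

Lemma garland_cons n d c m j : garland_form n d c m ->
  garland_form n.+1 (j + d) c (r (Y j) m).
Proof.
elim=> [|s sn sd|s a sn sd|a c1 c2 m1 m2 _ IH1 _ IH2].
- by rewrite rep0r; exact: garland0.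
- by apply: (@garland_word _ _ (j :: s)); rewrite /= ?sn ?sd.
- by rewrite ra_rep; apply: (@garland_low _ _ (j :: s)); rewrite /= ?sn ?ltn_add2l.
- by rewrite repDr repZr; exact: garland_lin.
Qed.

Lemma garland_ract n d d' c m a : garland_form n d c m -> (d < d')%N ->
  garland_form n d' 0 (ra m a).
Proof.
move=> G lt; elim: G => [|s sn sd|s b sn sd|b c1 c2 m1 m2 _ IH1 _ IH2].
- by rewrite ract0l; exact: garland0.
- by apply: garland_low; rewrite ?sd.
- by rewrite -ractM; apply: garland_low => //; exact: ltn_trans lt.
- by have := garland_lin b IH1 IH2; rewrite mulr0 addr0 ractDl ractZl.
Qed.

(** [H i] replaces each letter [Y j] in turn by [- kappa Y (i + j)]. When it reaches [w] it gives
    [eta i] without raising the degree, a lower term because [0 < i]. *)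
Lemma garland_H s i : (0 < i)%N ->
  garland_form (size s) (sumn s + i) (- kappa *+ size s) (r (H i) (Yword s)).
Proof.
move=> i0; elim: s => [|j s IH] /=.
  by rewrite Hw mulr0n; apply: (@garland_low _ _ [::]).
rewrite rep_swap HY repZl mulrSr -[- kappa in X in _ + X]mulr1; apply: garlandD.
  by rewrite -addnA; exact: garland_cons.
apply: garlandZ; apply: (@garland_word _ _ ((i + j)%N :: s)) => //=.
lia.
Qed.

(** Commuting [E] past a letter leaves some [H j.+1], which then hits every letter to its right; the
    binomial coefficient counts these pairs. *)
Lemma garland_E_word s n : size s = n.+1 ->
  garland_form n (sumn s).+1 (- kappa *+ 'C(n.+1, 2)) (r E (Yword s)).
Proof.
elim: s n => // j s IH n [sn]; rewrite /= rep_swap EY.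
case: n sn => [|n] sn.
  rewrite (size0nil sn) /= Ew rep0r add0r Hw bin_small // mulr0n.
  exact: (@garland_low _ _ [::]).
rewrite binS bin1 mulrnDr; apply: garlandD.
  by rewrite -addnS; apply: garland_cons; exact: IH.
by have := @garland_H s j.+1 isT; rewrite sn addnS addnC.
Qed.

Lemma garland_E n d c m : garland_form n.+1 d c m ->
  garland_form n d.+1 (c * (- kappa *+ 'C(n.+1, 2))) (r E m).
Proof.
elim=> [|s sn sd|s a sn sd|a c1 c2 m1 m2 _ IH1 _ IH2].
- by rewrite rep0r mul0r; exact: garland0.
- by rewrite mul1r -sd; exact: garland_E_word.
- by rewrite mul0r ra_rep; apply: garland_ract (garland_E_word sn) _.
- by rewrite repDr repZr mulrDl -mulrA; exact: garland_lin.
Qed.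

(** Each application of [E] removes a letter, raises the degree by one and multiplies the leading
    coefficient by some [- kappa 'C(n.+1, 2)] with at least two letters left, which is nonzero. *)
Lemma garland_iter n d c m : kappa != 0 -> c != 0 -> garland_form n.+1 d c m ->
  exists2 c', c' != 0 & garland_form 1 (d + n) c' (iter n (r E) m).
Proof.
move=> k0; elim: n d c m => [|n IH] d c m c0 G; first by exists c; rewrite ?addn0.
have [|c' c'0 G'] := IH _ _ _ _ (garland_E G).
  rewrite mulf_neq0 // -mulr_natr mulf_neq0 ?oppr_eq0 //.
  by case: ('C(_, _)) (bin_gt0 n.+2 2).
by exists c' => //; rewrite iterSr addnS -addSn.
Qed.

Lemma garland_form1 d c m : garland_form 1 d c m -> exists a : nat -> R,
  m = c *: r (Y d) w + \sum_(j < d) ra (r (Y j) w) (a j).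
Proof.
elim=> [|[|j[|//]] // _ jd|[|j[|//]] // b _ jd|b c1 c2 m1 m2 _ [a1 ->] _ [a2 ->]].
- by exists (fun=> 0); rewrite scale0r add0r big1 // => j _; rewrite ract0r.
- exists (fun=> 0); rewrite -jd /= addn0 scale1r big1 ?addr0 // => i _.
  by rewrite ract0r.
- rewrite /= addn0 in jd; exists (fun i => if i == j then b else 0); rewrite scale0r add0r.
  rewrite (bigD1 (Ordinal jd)) //= eqxx big1 ?addr0 // => i.
  by rewrite -val_eqE /= => /negPf->; rewrite ract0r.
- exists (fun j => ract_scalar ra b * a1 j + a2 j).
  rewrite scalerDr addrACA scalerA -scalerDl; congr (_ + _).
  rewrite scaler_sumr -big_split; apply: eq_bigr => j _.
  by rewrite ractDr ractM ract_scalarE ractZl.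
Qed.

(** Apply [E^n] to [Y_0^(n+1) w = 0]: a nonzero multiple of [Y_n w] plus terms in [Y_j w] with
    [j < n] remains. *)
Lemma garland n : kappa != 0 -> iter n.+1 (r (Y 0)) w = 0 ->
  exists a : nat -> R, r (Y n) w + \sum_(j < n) ra (r (Y j) w) (a j) = 0.
Proof.
move=> k0 nil; have G : garland_form n.+1 0 1 (Yword (nseq n.+1 0)).
  by apply: garland_word; rewrite ?size_nseq // sumn_nseq.
have wE : Yword (nseq n.+1 0) = 0 by rewrite -nil; elim: n.+1 {G nil} => //= k ->.
rewrite wE in G; have [c c0] := garland_iter k0 (oner_neq0 _) G.
rewrite iter_rep0 add0n => /garland_form1[a aE].
(* Division by the leading coefficient makes the relation monic. *)
exists (fun j => ract_scalar ra c^-1 * a j).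
move/(congr1 ( *:%R c^-1)): aE; rewrite scaler0 scalerDr scalerA mulVf // scale1r => aE.
rewrite [RHS]aE; congr (_ + _).
rewrite scaler_sumr; apply: eq_bigr => j _.
by rewrite ractM ract_scalarE ractZl.
Qed.

End Garland.

(** * Cyclic modules over the twisted loop algebra with a commuting right action *)

Section LoopModule.
Variables (K : fieldType) (g : fdLieAlgType K) (I : finType) (C : chevalley g I).
Variable T : twisting C.
Hypothesis char0 : forall n, n.+1%:R != 0 :> K.
Variables (M : lmodType K) (r : lieRep (LG T) M).
Variables (R : comNzRingType) (ra : rightAction R M).
Hypothesis ra_rep : forall x u a, r x (ra u a) = ra (r x u) a.

Local Notation h := (cartan C).
Local Notation sg := (diag_aut T).
Local Notation pi := (diag_perm T).
Local Notation m := (#[diag_perm T]%g).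
Local Notation zeta := (zeta T).
Local Notation tw := (tw T).

Variable w : M.
Hypothesis w_cyclic : forall Q : M -> Prop, lin_closed Q -> Q w ->
  (forall x u, Q u -> Q (r x u)) -> forall u, Q u.
Hypothesis w_cartan : forall x k, x \in h -> exists a, r (tw x k) w = ra w a.
Hypothesis w_nplus : forall x k, lie_gen (Xp C) x -> r (tw x k) w = 0.

Section Shift.
Variable delta : int.
Hypothesis zeta_delta : zeta ^ delta = 1.
Hypothesis w_nil : forall i, rep_nil r (tw (Xm C i) 0) w.

Let zeta_deltaM k : zeta ^ (delta * k) = 1.
Proof. by rewrite -exprz_exp zeta_delta exp1rz. Qed.

(** Garland's relation for the orbit sums of [X_i^+] and [X_i^-] in degrees divisible by [delta],
    where [zeta^delta = 1] removes the phases from the brackets. *)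
Lemma Xm_recurrent_at i : exists2 P : {poly R}, P \is monic &
  shift_poly ra delta P (fun n => r (tw (Xm C i) n) w) 0 = 0.
Proof.
pose q : K := (stab_order T i)%:R.
pose kappa := q * \sum_(s < m) av C i (Hc C ((pi ^+ s)%g i)).
pose Y j := tw (Xm C i) (delta * j%:Z); pose H j := q *: tw (Hc C i) (delta * j%:Z).
pose E := tw (Xp C i) delta.
have EY j : [Lie E, Y j] = H j.+1.
  rewrite tw_lie /H /q /stab_order natr_sum scaler_suml; apply: eq_bigr => s _.
  rewrite -mulrA zeta_deltaM scale1r (iter_diag_autX _ _ (diag_aut_Xm T)) Xp_Xm eq_sym.
  case: eqP => _; last by rewrite tw0 scale0r.
  by rewrite scale1r -addn1 PoszD mulrDr mulr1 addrC.
have HY a b : [Lie H a, Y b] = - kappa *: Y (a + b)%N.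
  rewrite lie_antisym lieZr tw_lie scaleNr -scalerA scaler_suml.
  congr (- (_ *: _)); apply: eq_bigr => s _.
  rewrite -mulrA zeta_deltaM scale1r (iter_diag_autX _ _ (diag_aut_Hc T)) lie_antisym.
  by rewrite Xm_weight ?Hc_mem // scaleNr opprK twZ /Y PoszD mulrDr addrC.
have Ew : r E w = 0 by apply: w_nplus; exact: lie_gen_in.
have /choice[eta etaE] : forall j, exists a, r (H j) w = ra w a.
  move=> j; have [a aE] := w_cartan (delta * j%:Z) (Hc_mem C i).
  by exists (ract_scalar ra q * a); rewrite repZl aE ractM ract_scalarE ractZl.
have k0 : kappa != 0 by rewrite mulf_neq0 ?stab_order_neq0 ?orbit_cartan_neq0.
have [N nil] := w_nil i.
have nilS : iter N.+1 (r (Y 0%N)) w = 0 by rewrite /Y mulr0 /= nil rep0r.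
have [a aE] := garland char0 ra_rep EY HY Ew etaE k0 nilS.
exists ('X^N + \poly_(j < N) a j).
  by rewrite monicE lead_coefDl ?lead_coefXn // size_polyXn ltnS size_poly.
rewrite shift_polyD [X in _ + X](@shift_poly_widen _ _ _ _ _ _ _ _ N) ?size_poly //.
rewrite -[RHS]aE; congr (_ + _).
  rewrite /shift_poly size_polyXn (bigD1 ord_max) //= coefXn eqxx ract1 add0r big1 ?addr0 // => j.
  by rewrite -val_eqE /= coefXn => /negPf->; rewrite ract0r.
by apply: eq_bigr => j _; rewrite coef_poly ltn_ord add0r.
Qed.

(** Bracketing the relation at index 0 with a Cartan element of degree [n] moves all indices by [n];
    the extra term is the old relation acted on by [a], hence zero. *)
Lemma Xm_recurrent i : recurrent ra delta (fun n => r (tw (Xm C i) n) w).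
Proof.
have [P Pm P0] := Xm_recurrent_at i; exists P => // n.
(* The fundamental coweight of [i]: among the translates of [X_i^-] only those equal to [X_i^-]
   survive, [stab_order] times. *)
have [x xh xE] := coweight C (fun j => (j == i)%:R).
have [a aE] := w_cartan n xh.
have E j : r (tw x n) (r (tw (Xm C i) (delta * j)) w) =
    ra (r (tw (Xm C i) (delta * j)) w) a
    - (stab_order T i)%:R *: r (tw (Xm C i) (n + delta * j)) w.
  rewrite rep_swap aE ra_rep; congr (_ + _); rewrite tw_lie rep_suml.
  rewrite /stab_order natr_sum scaler_suml -sumrN; apply: eq_bigr => s _.
  rewrite -mulrA zeta_deltaM scale1r (iter_diag_autX _ _ (diag_aut_Xm T)).
  rewrite Xm_weight // xE; case: eqP => [->|_]; last by rewrite oppr0 !scale0r tw0 rep0l oppr0.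
  by rewrite twZ scale1r repZl scaleN1r.
have := congr1 (r (tw x n)) P0; rewrite rep0r rep_sumr.
under eq_bigr => j _ do rewrite ra_rep add0r E ractDl ractNl ractZl ractC.
rewrite big_split /= sumrN -scaler_sumr -ract_suml.
under [X in ra X a]eq_bigr => j _ do rewrite -[delta * _]add0r.
rewrite -/(shift_poly _ _ _ (fun n => r (tw (Xm C i) n) w) 0) P0 ract0l add0r => /eqP.
rewrite oppr_eq0 scaler_eq0 (negPf (stab_order_neq0 T char0 i)) => /eqP; exact.
Qed.

Lemma shift_poly_rep P x b (u : int -> M) n :
  shift_poly ra delta P (fun k => r x (ra (u k) b)) n = r x (ra (shift_poly ra delta P u n) b).
Proof.
rewrite /shift_poly ract_suml rep_sumr; apply: eq_bigr => j _.
by rewrite !ra_rep ractC.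
Qed.

Lemma rep_recurrent x u : recurrent ra delta u -> recurrent ra delta (fun n => r x (u n)).
Proof.
move=> [P Pm Pu]; exists P => // n.
have := shift_poly_rep P x 1 u n; rewrite ract1 Pu rep0r => <-.
by apply: eq_shift_poly => k; rewrite ract1.
Qed.

(* In m tw [x, y] (n + d) = sum_c [tw x (n - c), tw y (c + d)] the shifts by P and
   by Q can be put on different factors. *)
Lemma recurrent_lie x y : recurrent ra delta (fun n => r (tw x n) w) ->
  recurrent ra delta (fun n => r (tw y n) w) ->
  recurrent ra delta (fun n => r (tw [Lie x, y] n) w).
Proof.
move=> [P Pm Px] [Q Qm Qy].
suff : recurrent ra delta (fun n => m%:R *: r (tw [Lie x, y] n) w).
  move/(recurrentZ m%:R^-1); apply: eq_recurrent => n.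
  by rewrite scalerA mulVf ?order_neq0 // scale1r.
exists (P * Q) => [|n]; first by rewrite rpredM.
rewrite shift_polyM.
pose F c j k := r (tw y (c%:Z + delta * j%:Z)) (ra (r (tw x (k - c%:Z)) w) Q`_j).
(* The shift of [Q] falls on the index of [y], so the products with [y] next to [w] cancel; in what
   remains [x] is next to [w], with index [k - c], ready for [P]. *)
have QE k : shift_poly ra delta Q (fun n => m%:R *: r (tw [Lie x, y] n) w) k
    = - 1 *: \sum_(c < m) \sum_(j < size Q) F c j k.
  rewrite /shift_poly; under eq_bigr => j _.
    rewrite -repZl tw_lie_separate // rep_suml ract_suml.
    under eq_bigr => c _ do rewrite rep_lie ractDl ractNl -ra_rep -[in X in _ - X]ra_rep.
    over.
  rewrite exchange_big scaler_sumr; apply: eq_bigr => c _.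
  rewrite sumrB scaleN1r -rep_sumr.
  by have := Qy c%:Z; rewrite /shift_poly => ->; rewrite rep0r sub0r.
rewrite (eq_shift_poly _ _ _ _ QE) shift_poly_seqZ shift_poly_seq_sum big1 ?scaler0 // => c _.
rewrite shift_poly_seq_sum big1 // => j _; rewrite shift_poly_rep.
by rewrite (shift_poly_translate _ _ _ (fun n => r (tw x n) w)) Px ract0l rep0r.
Qed.

Lemma lie_gen_recurrent x : span_of (lie_gen (Xm C)) x ->
  recurrent ra delta (fun n => r (tw x n) w).
Proof.
apply: (lin_closed_span_of (Q := fun x => recurrent ra delta (fun n => r (tw x n) w))) => [|{}x].
  split.
    by apply: eq_recurrent (recurrent0 ra delta) => n; rewrite tw0 rep0l.
  move=> a {}x y Rx Ry; apply: eq_recurrent (recurrentD (recurrentZ a Rx) Ry) => n.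
  by rewrite -repZl -twZ -repDl twD.
elim=> [i|{}x y _ Rx _ Ry]; [exact: Xm_recurrent|exact: recurrent_lie].
Qed.

End Shift.

Inductive nminus_word : nat -> M -> Prop :=
| nminus_word0 : nminus_word 0 w
| nminus_wordS k x n u : lie_gen (Xm C) x -> nminus_word k u ->
    nminus_word k.+1 (r (tw x n) u).

Section Recurrence.
Hypothesis w_nil : forall i, rep_nil r (tw (Xm C i) 0) w.

(** Move [tw x n] past the first letter of the word. The commutators are sums over Gamma of
    translates for [[x, sigma^s y]], which explains why the induction covers the whole span of
    monomials. *)
Lemma nminus_word_recurrent delta k u x : zeta ^ delta = 1 -> nminus_word k u ->
  span_of (lie_gen (Xm C)) x -> recurrent ra delta (fun n => r (tw x n) u).
Proof.
move=> zd wu; elim: wu x => [|{}k y c {}u yg _ IH] x xg; first exact: lie_gen_recurrent.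
have iterg s : span_of (lie_gen (Xm C)) (iter s sg y).
  apply: span_of_gen; elim: s => //= s; apply: lie_gen_diag => i; exact: diag_aut_Xm.
have Rs : recurrent ra delta (fun n => \sum_(s < m)
    zeta ^ (c * s%:Z) *: r (tw [Lie x, iter s sg y] (n + c)) u).
  apply: recurrent_sum => s; apply: recurrentZ.
  apply: (@recurrent_translate R K M ra delta c (fun n => r (tw [Lie x, iter s sg y] n) u)).
  by apply: IH; exact: lie_gen_span_lie.
apply: eq_recurrent (recurrentD (rep_recurrent (tw y c) (IH x xg)) Rs) => n.
rewrite [RHS]rep_swap tw_lie rep_suml; congr (_ + _); apply: eq_bigr => s _.
by rewrite repZl.
Qed.

(** Induction on the length: finitely many monomials spanning n^-, finitely many shorter words and
    finitely many exponents suffice, the last by the recurrences of steps [m] and [-m]. *)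
Lemma nminus_word_finite k : exists s : seq M, (forall u, u \in s -> nminus_word k u) /\
  forall u, nminus_word k u -> rspan ra (fun x => x \in s) u.
Proof.
elim: k => [|k [s [sw ws]]].
  exists [:: w]; split=> [u|u wu]; first by rewrite inE => /eqP ->; exact: nminus_word0.
  inversion wu; apply: rspan_gen; exact: mem_head.
have [B [Bg gB]] := finite_span (lie_gen (Xm C)).
have /choice[js jsE] : forall bu : g * M, exists js : seq int, lie_gen (Xm C) bu.1 ->
    bu.2 \in s -> forall n, rspan ra (fun x => exists2 j, j \in js & x = r (tw bu.1 j) bu.2)
      (r (tw bu.1 n) bu.2).
  move=> [b u] /=; case: (pselect (lie_gen (Xm C) b)) => [bg|]; last by exists [::].
  case: (boolP (u \in s)) => [us|]; last by exists [::].
  have zm : zeta ^ (m%:Z) = 1 by rewrite -[m%:Z]mul1r zeta_order.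
  have bS := span_of_gen bg.
  have [|js jsE] := recurrent_finite (order_gt0 pi) (nminus_word_recurrent zm (sw u us) bS).
    by apply: nminus_word_recurrent (sw u us) bS; rewrite -invr_expz zm invr1.
  by exists js.
exists [seq r (tw bu.1 j) bu.2 | bu <- [seq (b, u) | b <- B, u <- s], j <- js bu]; split.
  move=> _ /allpairsPdep[_ [j [/allpairsP[[b u] [bB us ->]] _ ->]]] /=.
  by apply: nminus_wordS; [exact: Bg|exact: sw].
move=> v vw; inversion vw as [|k' x n u xg uw]; subst.
have xu e : e \in s -> rspan ra (fun x =>
    x \in [seq r (tw bu.1 j) bu.2 | bu <- [seq (b, u) | b <- B, u <- s], j <- js bu])
  (r (tw x n) e).
  move=> es; have [c ->] := mem_span_sum (gB x xg).
  rewrite tw_sum rep_suml; apply: (lin_closed_sum (rspan_lin_closed _ _)) => i _.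
  rewrite twZ repZl; apply: (lin_closedZ (rspan_lin_closed _ _)).
  have iB : B`_i \in B by exact: mem_nth.
  apply: rspan_sub (jsE (B`_i, e) (Bg _ iB) es n) => _ [j jj ->]; apply: rspan_gen.
  apply/allpairsPdep; exists (B`_i, e), j; split=> //.
  by apply/allpairsP; exists (B`_i, e).
elim: (ws u uw) => [|e a e' es _ IH]; first by rewrite rep0r; exact: rspan0.
by rewrite repDr ra_rep; apply: rspanD => //; apply: rspan_ract; exact: xu.
Qed.

(* No ordering of monomials is needed: a word times any element of the loop algebra
   is rewritten by moving that element to w, where n^+ vanishes and h acts on the right. *)
Lemma nminus_word_span u : rspan ra (fun x => exists k, nminus_word k x) u.
Proof.
pose S := rspan ra (fun x => exists k, nminus_word k x).
have Slin : lin_closed S by exact: rspan_lin_closed.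
have Sact x : (forall k u, nminus_word k u -> S (r x u)) -> forall u, S u -> S (r x u).
  move=> Sx v; elim=> [|y a z [k yw] _ IH]; first by rewrite rep0r; exact: rspan0.
  rewrite repDr ra_rep; apply: rspanD => //; apply: rspan_ract; exact: Sx yw.
have Sword k v : nminus_word k v -> S v by move=> vw; apply: rspan_gen; exists k.
suff Sall k v : nminus_word k v -> forall x, S (r x v).
  apply: w_cyclic => //; first exact: Sword nminus_word0.
  by move=> x v; apply: Sact => k {}v vw; exact: Sall vw x.
elim=> [|{}k y c {}v yg vw IH] x.
  move: x; apply: tw_ind => //.
    split=> [|a x y Sx Sy]; first by rewrite rep0l; exact: rspan0.
    by rewrite repDl repZl; apply: (lin_closedD Slin) => //; exact: (lin_closedZ Slin).
  move=> x n; move: x; apply: (chevalley_ind (C := C)) => [|x xg|x xh|x xg].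
  - split=> [|a x y Sx Sy]; first by rewrite tw0 rep0l; exact: rspan0.
    by rewrite twD repDl twZ repZl; apply: (lin_closedD Slin) => //; exact: (lin_closedZ Slin).
  - by apply: (@Sword 1%N); apply: nminus_wordS => //; exact: nminus_word0.
  - by have [a ->] := w_cartan n xh; apply: rspan_ract; apply: Sword nminus_word0.
  - by rewrite w_nplus //; exact: rspan0.
rewrite rep_swap; apply: (lin_closedD Slin) => //; apply: Sact (IH x) => l u' u'w.
by apply: Sword; exact: nminus_wordS yg u'w.
Qed.

Theorem bounded_finite (N : nat) : (forall k u, nminus_word k u -> (N < k)%N -> u = 0) ->
  exists s : seq M, forall u, rspan ra (fun x => x \in s) u.
Proof.
move=> bound; have /choice[s sE] := nminus_word_finite.
exists (flatten [seq s k | k <- iota 0 N.+1]) => u.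
apply: rspan_sub (nminus_word_span u) => x [k xw].
have [kN|Nk] := leqP k N; last by rewrite (bound k x xw Nk); exact: rspan0.
apply: rspan_sub (proj2 (sE k) x xw) => y ys; apply: rspan_gen.
by apply/flatten_mapP; exists k; rewrite // mem_iota.
Qed.

End Recurrence.
End LoopModule.

(** * Bounding the length of words by the principal sl_2 *)

Section GradedModule.
Variables (K : fieldType) (g : fdLieAlgType K) (I : finType) (C : chevalley g I).
Variable T : twisting C.
Hypothesis char0 : forall n, n.+1%:R != 0 :> K.
Variables (M : lmodType K) (r : lieRep (LG T) M).
Variable w : M.
Hypothesis w_cyclic : forall Q : M -> Prop, lin_closed Q -> Q w ->
  (forall x u, Q u -> Q (r x u)) -> forall u, Q u.

Local Notation h := (cartan C).
Local Notation m := (#[diag_perm T]%g).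
Local Notation tw := (tw T).

(** [Gr d] abstracts the sum of the weight spaces at height [d] below the highest weight; [z] is
    [2 rho^vee] and [Lambda] is its eigenvalue at height 0. *)
Variables (z : g0 T) (Gr : int -> M -> Prop) (Lambda : K).
Hypotheses (zh : val z \in h) (z2 : forall i, av C i (val z) = 2%:R).
Hypotheses (Gr_lin : forall d, lin_closed (Gr d)) (Gr_w : Gr 0 w).
Hypothesis Gr_tw : forall (beta : dual h) (c d : int) x k u,
  root_space beta x -> (beta (vsproj h (val z)) : K) = 2%:R * c%:~R -> Gr d u ->
  Gr (d - c) (r (tw x k) u).
Hypothesis Gr_neg : forall d u, d < 0 -> Gr d u -> u = 0.
Hypothesis Gr_z : forall d u, Gr d u -> r (g0_incl T z) u = (Lambda - 2%:R * d%:~R) *: u.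
Hypothesis w_nil : forall y : g0 T, [Lie val z, val y] = - 2%:R *: val y ->
  rep_nil r (g0_incl T y) w.

Lemma Gr_nplus x k d u : lie_gen (Xp C) x -> Gr d u -> exists n : nat,
  Gr (d - n.+1%:Z) (r (tw x k) u).
Proof.
move=> xg Gu; have [|beta [n [bx bn]]] :=
  lie_gen_weight (z := vsproj h (val z)) (c := 2%:R) (@Xp_root _ _ _ C) _ xg; first exact: z2.
by exists n; apply: Gr_tw bx _ Gu; rewrite bn -[LHS]mulr_natr.
Qed.

Lemma Gr_nminus x k d u : lie_gen (Xm C) x -> Gr d u -> exists n : nat,
  Gr (d + n.+1%:Z) (r (tw x k) u).
Proof.
move=> xg Gu; have [|beta [n [bx bn]]] :=
  lie_gen_weight (z := vsproj h (val z)) (c := - 2%:R) (@Xm_root _ _ _ C) _ xg.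
  by move=> i; rewrite opp_lfunE; congr (- _); exact: z2.
exists n; rewrite -[n.+1%:Z]opprK; apply: Gr_tw bx _ Gu.
by rewrite bn -[LHS]mulr_natr mulNr -mulrN; congr (_ * _); rewrite mulrNz.
Qed.

Lemma w_nplus x k : lie_gen (Xp C) x -> r (tw x k) w = 0.
Proof. by move=> xg; have [n] := Gr_nplus k xg Gr_w; apply: Gr_neg; lia. Qed.

Lemma w_nil_Xm i : rep_nil r (tw (Xm C i) 0) w.
Proof.
have yg : isotypic T 0 (Xm C i) \in g0_pred T.
  by rewrite unfold_in /g0_pred -{2}isotypic_diag expr0z scale1r.
pose y : g0 T := exist (fun x => x \in g0_pred T) _ yg.
have <- : g0_incl T y = tw (Xm C i) 0 by apply/val_inj.
apply: w_nil => /=; rewrite /isotypic lie_sumr scaler_sumr; apply: eq_bigr => s _.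
rewrite lieZr -[val z in LHS](iter_g0 z s) -iter_diag_aut_lie Xm_weight // z2.
by rewrite iter_diag_autZ !scalerA mulrC.
Qed.

(** [ad y] is locally nilpotent on the loop algebra because it is on g, so nilpotency of [y] at the
    cyclic vector spreads to the whole module. *)
Lemma g0_nil (y : g0 T) kappa : [Lie val z, val y] = - kappa *: val y -> kappa != 0 ->
  rep_nil r (g0_incl T y) w -> forall u, rep_nil r (g0_incl T y) u.
Proof.
move=> zy k0 yw; apply: w_cyclic => //; first exact: rep_nil_lin_closed.
move=> x u; apply: rep_nil_act; move: x; apply: tw_ind => //.
  exact: (rep_nil_lin_closed (adjoint_rep (LG T))).
move=> x k; have [n En] := ad_nil char0 x zh z2 zy k0.
exists n; transitivity (tw (iter n (lie (val y)) x) k); last by rewrite [iter _ _ _]En tw0.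
by elim: n {En} => //= n ->; rewrite g0_lie_tw.
Qed.

Lemma Gr_bound d u : Gr d u -> u != 0 -> exists2 N : nat, Lambda = N%:R & d <= N%:Z.
Proof.
move=> Gu u0; have [c [/eqP eg /eqP fg ef ze zf]] := principal_sl2 T zh z2.
set e := \sum_i Xp C i in eg ef ze; set f := \sum_i _ in fg ef zf.
pose e0 : g0 T := exist (fun x => x \in g0_pred T) e eg.
pose f0 : g0 T := exist (fun x => x \in g0_pred T) f fg.
have two0 := char0 1.
have fnil v : rep_nil r (g0_incl T f0) v.
  by apply: (g0_nil (kappa := 2%:R)) => //; exact: w_nil.
have Ge d' v : Gr d' v -> Gr (d' - 1) (r (g0_incl T e0) v).
  (* As [e] is fixed by sigma, its orbit sum in degree 0 is [m] times [e], which brings [Gr_tw] into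
     play root vector by root vector. *)
  move=> Gv; have : Gr (d' - 1) (m%:R^-1 *: r (tw e 0) v).
    apply: (lin_closedZ (Gr_lin _)); rewrite tw_sum rep_suml.
    apply: (lin_closed_sum (Gr_lin _)) => i _.
    by apply: Gr_tw (@Xp_root _ _ _ C i) _ Gv; rewrite mulr1; exact: z2.
  by rewrite -[e]/(val e0) tw_g0 repZl scalerA mulVf ?order_neq0 // scale1r.
have Gf d' v : Gr d' v -> Gr (d' + 1) (r (g0_incl T f0) v).
  move=> Gv; have : Gr (d' + 1) (m%:R^-1 *: r (tw f 0) v).
    apply: (lin_closedZ (Gr_lin _)); rewrite tw_sum rep_suml.
    apply: (lin_closed_sum (Gr_lin _)) => i _; rewrite twZ repZl.
    apply: (lin_closedZ (Gr_lin _)); rewrite -[X in d' + X]opprK.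
    apply: Gr_tw (@Xm_root _ _ _ C i) _ Gv; rewrite opp_lfunE mulrN1.
    by congr (- _); exact: z2.
  by rewrite -[f]/(val f0) tw_g0 repZl scalerA mulVf ?order_neq0 // scale1r.
have Gfk k : Gr (d + k%:Z) (iter k (r (g0_incl T f0)) u).
  elim: k => [|k IH]; first by rewrite addr0.
  by rewrite -addn1 PoszD addrA addn1; exact: Gf.
have Gej k j : Gr (d + k%:Z - j%:Z) (iter j (r (g0_incl T e0)) (iter k (r (g0_incl T f0)) u)).
  elim: j => [|j IH]; first by rewrite subr0.
  by rewrite -addn1 PoszD opprD addrA addn1; exact: Ge.
have inclE (x y v : g0 T) a : [Lie val x, val y] = a *: val v ->
    [Lie g0_incl T x, g0_incl T y] = a *: g0_incl T v.
  by move=> E; rewrite -(lieHom_lie (g0_incl T)) -linearZ; congr g0_incl_fun; apply/val_inj.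
have ef' : [Lie g0_incl T e0, g0_incl T f0] = g0_incl T z.
  by rewrite (inclE _ _ z 1) ?scale1r.
have := @rep_lowest_weight _ _ _ r (g0_incl T e0) (g0_incl T f0) (g0_incl T z) 2%:R ef'
  (inclE z e0 e0 _ ze) _ u (inclE z f0 f0 _ zf) (Gr_z Gu) u0 (fnil u).
case=> [k|k [j [_ nz E]]].
  (* Each [e] lowers the degree by one, so this many take [f^k u] below degree 0. *)
  exists (absz (d + k%:Z)%R).+1; apply: Gr_neg (Gej _ _); lia.
have jd : (0 <= d + k%:Z - j%:Z)%R.
  by rewrite Order.TotalTheory.leNgt; apply/negP => /Gr_neg/(_ (Gej k j))/eqP; rewrite (negPf nz).
(* The weight [Lambda - 2 d - 2 k] of [f^k u] will turn out to be [- j], so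
   [Lambda = 2 (d + k) - j]; as [j <= d + k], this is at least [d]. *)
pose N := absz (2 * (d + k%:Z) - j%:Z)%R.
have NE : N%:Z = 2 * (d + k%:Z) - j%:Z by rewrite /N; lia.
exists N; last by lia.
have CE : 2%:R *+ 'C(j.+1, 2) = j%:R *+ j.+1 :> K.
  by rewrite -!mulrnA -(mul_bin_diag j.+1 1) bin1 mulnC.
move/eqP: E; rewrite CE -mulrnDl -[X in X == _]mulr_natr mulf_eq0 (negPf (char0 j)) orbF.
move=> /eqP E; rewrite -[N%:R]/(N%:Z%:~R) NE.
have -> : Lambda = Lambda - 2%:R * d%:~R - 2%:R *+ k + j%:R + (2%:R * d%:~R + 2%:R *+ k - j%:R).
  by ring.
by rewrite E add0r; ring.
Qed.

Lemma nminus_word_Gr k u : nminus_word r w k u -> exists2 d : nat, (k <= d)%N & Gr d%:Z u.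
Proof.
elim=> [|x l n {}u xg _ [d ld Gu]]; first by exists 0%N.
have [j Gj] := Gr_nminus n xg Gu; exists (d + j.+1)%N; last by rewrite PoszD.
by rewrite addnS ltnS (leq_trans ld) // leq_addr.
Qed.

(** A word with [k] letters has degree at least [k], and nonzero vectors have degree at most
    [Lambda]. If [Lambda] is not a natural number, every graded piece is zero. *)
Lemma nminus_word_bound : exists N : nat, forall k u,
  nminus_word r w k u -> (N < k)%N -> u = 0.
Proof.
case: (pselect (exists N : nat, Lambda = N%:R)) => [[N LN]|noN]; last first.
  exists 0%N => k u /nminus_word_Gr[d _ Gu] _; case: (eqVneq u 0) => // u0.
  by have [N LN _] := Gr_bound Gu u0; case: noN; exists N.
exists N => k u /nminus_word_Gr[d kd Gu] Nk; case: (eqVneq u 0) => // u0.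
have [N' LN' dN] := Gr_bound Gu u0.
have NN' : N = N' by apply: (nat_scale_inj char0 (oner_neq0 K)); rewrite -LN.
lia.
Qed.

Theorem graded_finite (R : comNzRingType) (ra : rightAction R M) :
  (forall x u a, r x (ra u a) = ra (r x u) a) ->
  (forall x k, x \in h -> exists a, r (tw x k) w = ra w a) ->
  exists s : seq M, forall u, rspan ra (fun x => x \in s) u.
Proof.
move=> ra_rep w_cartan; have [N bound] := nminus_word_bound.
exact: (bounded_finite char0 ra_rep w_cyclic w_cartan w_nplus w_nil_Xm bound).
Qed.

End GradedModule.

(** * The global Weyl module *)

Section RestrictScalars.
Variables (K : fieldType) (A : algType K) (V : lmodType A).

(** A copy of [V] with scalars restricted to [K] along [c%:A], so that linear algebra over the field
    applies. *)
Definition restr : Type := V.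
HB.instance Definition _ := GRing.Zmodule.on restr.

Definition restr_scale (a : K) (v : restr) : restr := (a%:A : A) *: (v : V).

Fact restr_scaleA a b v : restr_scale a (restr_scale b v) = restr_scale (a * b) v.
Proof. by rewrite /restr_scale scalerA mulr_algl scalerA. Qed.
Fact restr_scale1 : left_id 1 restr_scale.
Proof. by move=> v; rewrite /restr_scale !scale1r. Qed.
Fact restr_scaleDr : right_distributive restr_scale +%R.
Proof. by move=> a u v; rewrite /restr_scale scalerDr. Qed.
Fact restr_scaleDl v : {morph restr_scale^~ v : a b / a + b}.
Proof. by move=> a b; rewrite /restr_scale !scalerDl. Qed.
HB.instance Definition _ := GRing.Zmodule_isLmodule.Build K restr
  restr_scaleA restr_scale1 restr_scaleDr restr_scaleDl.

Lemma restr_scaleE (a : K) (v : restr) : a *: v = ((a%:A : A) *: (v : V) : V).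
Proof. by []. Qed.

Lemma restr_scale_alg (a : K) (x : A) (v : V) : (a *: x) *: v = a *: (x *: v : restr) :> restr.
Proof. by rewrite restr_scaleE scalerA mulr_algl. Qed.
End RestrictScalars.

Section EnvRep.
Variables (K : fieldType) (L : lieAlgType K) (V : lmodType (env L)).

Definition env_act (x : L) (v : restr V) : restr V := envU L x *: (v : V).

Fact env_act_linearl v : linear (env_act^~ v).
Proof. by move=> a x y; rewrite /env_act linearP scalerDl restr_scale_alg. Qed.

Fact env_act_linearr x : linear (env_act x).
Proof.
move=> a u v; rewrite /env_act [a *: u]restr_scaleE scalerDr restr_scaleE !scalerA.
by rewrite mulr_algl mulr_algr.
Qed.

Fact env_act_lie x y v : env_act [Lie x, y] v = env_act x (env_act y v) - env_act y (env_act x v).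
Proof. by rewrite /env_act lieAssoc_lie scalerBl !scalerA. Qed.

Definition env_rep : lieRep L (restr V) := LieRep env_act_linearl env_act_linearr env_act_lie.

Lemma env_repE x v : env_rep x v = (envU L x *: (v : V) : V).
Proof. by []. Qed.

Lemma env_rep_cyclic (w : V) (Q : restr V -> Prop) : lin_closed Q -> Q w ->
  (forall x u, Q u -> Q (env_rep x u)) -> forall u : env L, Q (u *: w).
Proof.
move=> Qlin Qw Qact u; elim/env_ind: u => [|a u v Qu Qv|x u Qu].
- by rewrite scale1r.
- by rewrite scalerDl restr_scale_alg; case: Qlin => _; apply.
- by have := Qact x _ Qu; rewrite env_repE scalerA.
Qed.
End EnvRep.

Section Tensor.
Variables (R S : nzRingType) (phi : {rmorphism S -> R}) (V : lmodType S).
Local Notation tens := (@tens R S phi V).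

Lemma scale_tens (a b : R) (v : V) : a *: tens b v = tens (a * b) v.
Proof. by rewrite /tens -linearZ /= scalerA. Qed.

Lemma tens_scale (a : R) (s : S) (v : V) : tens a (s *: v) = tens (a * phi s) v.
Proof.
apply/eqP; rewrite -subr_eq0 /tens -raddfB /= lpi_eq0 -scalerA -scalerBr.
by apply: rpredZ; apply/asboolP/span_of_gen; exact: tensor_rel_scale.
Qed.

Lemma tens1_scale (s : S) (v : V) : tens 1 (s *: v) = phi s *: tens 1 v.
Proof. by rewrite tens_scale scale_tens mul1r mulr1. Qed.

Lemma ext_scalars_ind (Q : ext_scalars phi V -> Prop) :
  Q 0 -> (forall x y, Q x -> Q y -> Q (x + y)) -> (forall a v, Q (tens a v)) -> forall x, Q x.
Proof.
move=> Q0 QD Qt x; have [y ->] := lpiP x; rewrite [y]monalgE raddf_sum.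
elim/big_ind: _ => // v _; have := Qt y@_v v.
congr (Q (lpi _ _)); apply/malgP => k; rewrite mcoeffZ !mcoeffU.
by rewrite mulrnAr mulr1.
Qed.
End Tensor.

(** * Cyclicity and right action of the global Weyl module *)

Section GlobalWeyl.
Variables (K : fieldType) (g : fdLieAlgType K) (I : finType) (C : chevalley g I).
Variables (T : twisting C) (I0 : {set I}) (lambda : dual (h0 T)).
Variables (V : lmodType (env (g0 T))) (v : V).
Hypothesis Vsimple : simple_lmod V.
Hypothesis v_highest : highest_weight_vector lambda v.

Local Notation h := (cartan C).
Local Notation U := (env (LG T)).
Local Notation phi := (env_map (g0_incl T)).
Local Notation Ind := (weyl_ind V).
Local Notation W := (global_weyl I0 lambda V).
Local Notation w := (weyl_gen I0 lambda v).
Local Notation proj := (lpi (submod_gen (weyl_rel I0 lambda (V := V)))).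

Lemma V_cyclic (v' : V) : exists a : env (g0 T), v' = a *: v.
Proof.
have [v0 _ _] := v_highest; have [_ simp] := Vsimple.
have [||all0|//] := simp (fun v' => exists a : env (g0 T), v' = a *: v).
- by exists 0; rewrite scale0r.
- by move=> a _ _ [b ->] [c ->]; exists (a * b + c); rewrite scalerDl scalerA.
by case: v0; apply: all0; exists 1; rewrite scale1r.
Qed.

(** A tensor of [a] with [b *: v] is [a * phi b] applied to that of 1 with [v], and [v] generates
    the simple module [V]. *)
Lemma weyl_cyclic (u : W) : exists a : U, u = a *: w.
Proof.
have [u' ->] := lpiP u; move: u'; apply: ext_scalars_ind => [|x y [a Ea] [b Eb]|a v'].
- by exists 0; rewrite raddf0 scale0r.
- by exists (a + b); rewrite raddfD /= Ea Eb scalerDl.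
have [b ->] := V_cyclic v'; exists (a * phi b).
by rewrite tens_scale /weyl_gen -linearZ /= scale_tens mulr1.
Qed.

Lemma weyl_rep_cyclic (Q : restr W -> Prop) : lin_closed Q -> Q w ->
  (forall x u, Q u -> Q (env_rep W x u)) -> forall u, Q u.
Proof. by move=> Qlin Qw Qact u; have [a ->] := weyl_cyclic u; exact: env_rep_cyclic. Qed.

Section RightAction.
Variable act : right_module (weyl_alg I0 lambda v) W.
Hypothesis actE : forall (u : U) (a : env (LGh T)),
  rmul act (u *: w) (weyl_alg_pi I0 lambda v a) = (u * env_map (LGh_incl T) a) *: w.

(** The action is pulled back to [env (LGh T)], a nonzero commutative ring, as [rightAction]
    requires; [weyl_alg] is the zero ring when [w] vanishes. *)
Definition weyl_ract (u : restr W) (a : env (LGh T)) : restr W :=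
  rmul act u (weyl_alg_pi I0 lambda v a).

Lemma weyl_ractDl a : {morph weyl_ract^~ a : x y / x + y}.
Proof. by move=> x y; rewrite /weyl_ract rmulDl. Qed.

Lemma weyl_ractDr u : {morph weyl_ract u : a b / a + b}.
Proof. by move=> a b; rewrite /weyl_ract /weyl_alg_pi raddfD rmulDr. Qed.

Lemma weyl_ract1 u : weyl_ract u 1 = u.
Proof. by rewrite /weyl_ract /weyl_alg_pi rmorph1 rmul1. Qed.

Lemma weyl_ractM u a b : weyl_ract u (a * b) = weyl_ract (weyl_ract u a) b.
Proof. by rewrite /weyl_ract /weyl_alg_pi rmorphM rmulM. Qed.

Lemma weyl_ract_scalar u (c : K) : weyl_ract u (c%:A) = c *: u.
Proof.
have [a ->] := weyl_cyclic u; rewrite /weyl_ract actE linearZ rmorph1 /= restr_scaleE scalerA.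
by rewrite mulr_algl mulr_algr.
Qed.

Definition weyl_action : rightAction (env (LGh T)) (restr W) :=
  RightAction weyl_ractDl weyl_ractDr weyl_ract1 weyl_ractM weyl_ract_scalar.

Lemma weyl_action_rep x u a :
  env_rep W x (weyl_action u a) = weyl_action (env_rep W x u) a.
Proof.
have [b ->] := weyl_cyclic u.
rewrite /weyl_action /= /weyl_ract /env_act actE [in RHS]scalerA actE.
by rewrite scalerA mulrA.
Qed.

Lemma weyl_action_cartan x k : x \in h ->
  exists a, env_rep W (tw T x k) w = weyl_action w a.
Proof.
move=> xh; have [y yE] := tw_LGh T k xh; exists (envU (LGh T) y).
rewrite /= /env_act /weyl_ract -[X in rmul _ X](scale1r w) actE mul1r env_map_in.
by rewrite yE.
Qed.

End RightAction.
End GlobalWeyl.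

Section EnvMap.
Variables (K : fieldType) (L1 L2 : lieAlgType K) (f : lieHom L1 L2).

Lemma env_map_alg (c : K) : env_map f c%:A = c%:A.
Proof. by rewrite linearZ rmorph1. Qed.

Lemma tens1_envU (V : lmodType (env L1)) (x : L1) (u : V) :
  tens (env_map f) 1 (envU L1 x *: u) = envU L2 (f x) *: tens (env_map f) 1 u.
Proof. by rewrite tens1_scale /= env_map_in. Qed.

Lemma tens1_alg (V : lmodType (env L1)) (c : K) (u : V) :
  tens (env_map f) 1 ((c%:A : env L1) *: u) = (c%:A : env L2) *: tens (env_map f) 1 u.
Proof. by rewrite tens1_scale /= env_map_alg. Qed.

Lemma tens1_0 (V : lmodType (env L1)) : tens (env_map f) 1 (0 : V) = 0.
Proof. by rewrite -(scale0r (0 : V)) tens1_scale rmorph0 scale0r. Qed.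
End EnvMap.

(** * The height grading of the global Weyl module *)

Section WeylGrading.
Variables (K : fieldType) (g : fdLieAlgType K) (I : finType) (C : chevalley g I).
Variables (T : twisting C) (I0 : {set I}) (lambda : dual (h0 T)).
Variables (V : lmodType (env (g0 T))) (v : V).
Hypothesis char0 : forall n, n.+1%:R != 0 :> K.
Hypothesis Vfin : fin_dim V.
Hypothesis v_highest : highest_weight_vector lambda v.

Local Notation h := (cartan C).
Local Notation U := (env (LG T)).
Local Notation phi := (env_map (g0_incl T)).
Local Notation Ind := (weyl_ind V).
Local Notation W := (global_weyl I0 lambda V).
Local Notation w := (weyl_gen I0 lambda v).
Local Notation proj := (lpi (submod_gen (weyl_rel I0 lambda (V := V)))).

Lemma weight_vectorE (L : lieAlgType K) (f : g0 T -> L) (N : lmodType (env L))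
    (mu : dual (h0 T)) (u : N) (x : g0 T) : weight_vector f mu u -> val x \in h ->
  env_rep N (f x) u = (mu (vsproj (h0 T) (val x)) : K) *: (u : restr N).
Proof. by move=> mu_u xh; exact: (mu_u x xh). Qed.

Lemma weight_vectorI (L : lieAlgType K) (f : g0 T -> L) (N : lmodType (env L))
    (mu : dual (h0 T)) (u : N) : (forall x : g0 T, val x \in h ->
  env_rep N (f x) u = (mu (vsproj (h0 T) (val x)) : K) *: (u : restr N)) -> weight_vector f mu u.
Proof. by move=> E x xh; move: (E x xh); rewrite env_repE restr_scaleE. Qed.

Lemma ind_weight : weight_vector (g0_incl T) lambda (tens phi 1 v : Ind).
Proof.
have [_ _ vw] := v_highest; apply: weight_vectorI => x xh.
have := congr1 (tens phi 1) (vw x xh).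
by rewrite tens1_envU tens1_alg.
Qed.

Lemma weight_vector_tw (beta : dual h) (mu : dual (h0 T)) x k (u : Ind) :
  root_space beta x -> weight_vector (g0_incl T) mu u ->
  weight_vector (g0_incl T) (mu + res0 T beta) (envU (LG T) (tw T x k) *: u).
Proof.
move=> bx mu_u; apply: weight_vectorI => y yh; rewrite -[_ *: u]/(env_rep Ind (tw T x k) u).
have yh0 : val y \in h0 T.
  by rewrite memv_cap yh; apply/fixedSpaceP/eqP; exact: valP y.
rewrite rep_swap (weight_vectorE mu_u yh) repZr g0_lie_tw (root_spaceE bx yh) twZ repZl.
by rewrite -scalerDl add_lfunE res0E vsprojK.
Qed.

Variable z : g0 T.
Hypotheses (zh : val z \in h) (z2 : forall i, av C i (val z) = 2%:R).

Local Notation z0 := (vsproj (h0 T) (val z)).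

Let zh0 : val z \in h0 T.
Proof. by rewrite memv_cap zh; apply/fixedSpaceP/eqP; exact: valP z. Qed.

Lemma res0_z beta : res0 T beta z0 = beta (vsproj h (val z)).
Proof. by rewrite res0E vsprojK. Qed.

(* When z is 2 rho^vee, d is the height of lambda - mu. *)
Definition weyl_grade (d : int) : restr W -> Prop := span_of (fun u : restr W =>
  exists2 mu : dual (h0 T), ((lambda - mu) z0 : K) = 2%:R * d%:~R &
  exists2 u' : Ind, weight_vector (g0_incl T) mu u' & u = proj u').

Lemma env_rep_proj x (u : Ind) : env_rep W x (proj u) = proj (envU (LG T) x *: u).
Proof. by rewrite env_repE linearZ. Qed.

Lemma weyl_grade_gen : weyl_grade 0 w.
Proof.
apply: span_of_gen; exists lambda; first by rewrite subrr mulr0 zero_lfunE.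
by exists (tens phi 1 v) => //; exact: ind_weight.
Qed.

Lemma weyl_grade_tw (beta : dual h) (c d : int) x k u :
  root_space beta x -> (beta (vsproj h (val z)) : K) = 2%:R * c%:~R -> weyl_grade d u ->
  weyl_grade (d - c) (env_rep W (tw T x k) u).
Proof.
move=> bx bc; apply: (lin_closed_span_of (Q := fun u => weyl_grade _ (env_rep W _ u))).
  split=> [|a u1 u2 G1 G2]; first by rewrite rep0r; exact: span_of0.
  by rewrite repDr repZr; exact: span_of_lin.
move=> {}u [mu mud [u' u'mu ->]]; apply: span_of_gen; exists (mu + res0 T beta).
  by rewrite opprD addrA add_lfunE mud opp_lfunE res0_z bc rmorphB mulrBr.
exists (envU (LG T) (tw T x k) *: u'); first exact: weight_vector_tw.
exact: env_rep_proj.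
Qed.

(** An element of [Q0plus] takes at [z] twice a natural number, so a weight of negative height is
    among those divided out. *)
Lemma weyl_grade_neg d u : d < 0 -> weyl_grade d u -> u = 0.
Proof.
move=> d0; apply: (lin_closed_span_of (Q := fun u => u = 0)).
  by split=> // a x y -> ->; rewrite scaler0 addr0.
move=> {}u [mu mud [u' u'mu ->]]; apply/eqP; rewrite lpi_eq0; apply/asboolP/span_of_gen.
exists mu => // -[n nE]; move: mud; rewrite nE sum_lfunE.
under eq_bigr => i _ do rewrite -scaler_nat scale_lfunE res0_z -[alpha C i _]/(av C i _) z2.
have -> : \sum_(i in I0) (n i)%:R *: (2%:R : K^o) = 2%:R * (\sum_(i in I0) n i)%:R :> K.
  by rewrite natr_sum mulr_sumr; apply: eq_bigr => i _; rewrite [LHS]mulrC.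
move/mulfI => /(_ (char0 1)); move: (\sum_(i in I0) n i)%N => N.
have -> : d = - ((absz d).-1.+1)%:Z by lia.
by rewrite mulrNz -pmulrn => /eqP; rewrite -addr_eq0 -natrD addnS (negPf (char0 _)).
Qed.

Lemma weyl_grade_z d u : weyl_grade d u ->
  env_rep W (g0_incl T z) u = (lambda z0 - 2%:R * d%:~R : K) *: u.
Proof.
apply: (lin_closed_span_of (Q := fun u => env_rep W _ u = _ *: u)).
  split=> [|a x y Ex Ey]; first by rewrite rep0r scaler0.
  by rewrite repDr repZr Ex Ey scalerDr !scalerA mulrC.
move=> {}u [mu mud [u' u'mu ->]].
have muE : (mu z0 : K) = lambda z0 - 2%:R * d%:~R.
  by rewrite -mud add_lfunE opp_lfunE opprB addrC subrK.
by rewrite -muE env_rep_proj (u'mu z zh) linearZ.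
Qed.

(** [y] shifts the eigenvalues of [z] on the finite-dimensional [V], hence is nilpotent at [v]; the
    map from [V] to the global Weyl module carries this to [w]. *)
Lemma weyl_nil (y : g0 T) : [Lie val z, val y] = - 2%:R *: val y ->
  rep_nil (env_rep W) (g0_incl T y) w.
Proof.
move=> zy; have [_ _ vw] := v_highest; have [d [e eE]] := Vfin.
have zy' : [Lie z, y] = - 2%:R *: y by apply/val_inj.
have [n En] := @rep_nil_findim _ _ _ (env_rep V) char0 z y 2%:R (lambda z0) v d e
  eE zy' (char0 1) (weight_vectorE vw zh).
exists n; have iterE k : iter k (env_rep W (g0_incl T y)) w
    = proj (tens phi 1 (iter k (env_rep V y) v)).
  elim: k => [|k IH]; first exact: erefl.
  by rewrite !iterS IH env_rep_proj env_repE tens1_envU.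
by rewrite iterE En tens1_0 raddf0.
Qed.

End WeylGrading.

Theorem theorem4p4 (R : realType) (g : fdLieAlgType R[i]) (I : finType)
    (C : chevalley g I) (T : twisting C) (I0 : {set I})
    (lambda : dual (h0 T)) (V : lmodType (env (g0 T))) (v : V)
    (act : right_module (weyl_alg I0 lambda v) (global_weyl I0 lambda V)) :
  lie_simple g ->
  is_transversal I0 (porbits (diag_perm T)) [set: I] ->
  P0plus I0 lambda ->
  simple_lmod V ->
  fin_dim V ->
  highest_weight_vector lambda v ->
  (forall (u : env (LG T)) (a : env (LGh T)),
     rmul act (u *: weyl_gen I0 lambda v) (weyl_alg_pi I0 lambda v a)
     = (u * env_map (LGh_incl T) a) *: weyl_gen I0 lambda v) ->
  finitely_generated act.
Proof.
move=> _ _ _ Vsimple Vfin v_highest actE.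
have char0 n : n.+1%:R != 0 :> R[i] by rewrite Num.Theory.pnatr_eq0.
(* This is [2 rho^vee]; it lies in g_0 because its values on the simple roots are all equal. *)
have [z zh z2] : exists2 z : g0 T, val z \in cartan C & forall i, av C i (val z) = 2%:R.
  have [z zh z2] := coweight C (fun=> 2%:R).
  have zg : z \in g0_pred T by apply/eqP; exact: (diag_fixed zh z2).
  by exists (exist (fun x => x \in g0_pred T) z zg).
have [s sE] := graded_finite char0 (weyl_rep_cyclic (I0 := I0) Vsimple v_highest)
  (z := z) (Gr := weyl_grade z) zh z2 (fun d => span_of_lin_closed _)
  (weyl_grade_gen I0 v_highest z) (weyl_grade_tw zh) (weyl_grade_neg char0 zh z2)
  (weyl_grade_z zh) (weyl_nil I0 char0 Vfin v_highest zh)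
  (weyl_action_rep Vsimple v_highest actE) (weyl_action_cartan Vsimple v_highest actE).
(* [env (LGh T)] acts through its quotient [weyl_alg], so the same generators serve and the
   coefficients are projected. *)
exists (size s), (fun i : 'I_(size s) => s`_i) => u.
have [a ->] := rspan_seq (sE u).
by exists (fun i => weyl_alg_pi I0 lambda v (a i)).
Qed.
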